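(* Let $K, C, C_1, C_{\rm x}>0$. There exist constants $\mathcal{C}_2,\mathcal{C}_2'>0$ depending only on $K, C, C_1, C_{\rm x}$ such that the following holds. Let $\tau\in(0,1)$, let $n,d$ be positive integers, let $\mathbf{P}$ be a distribution on $\mathbb{R}\times\mathbb{R}^d$, and let $(Y_i,X_i)_{i=1,\dots,n}$ be i.i.d. from $\mathbf{P}$. Let $\theta^*\in\arg\min_{\theta\in\mathbb{R}^d}R(\theta)$, $s^*=\|\theta^*\|_0$ and $R^*=R(\theta^* )$. Assume that: (i) $\mathbb{E}\|X_1\|\le C_{\rm x}$; (ii) for every $\theta\in B_1(C_1)$, $\mathbb{E}\{|X^\top(\theta-\theta^* )|^2\}\le K[R(\theta)-R(\theta^* )]$, where $(Y,X)\sim\mathbf{P}$; (iii) the loss is bounded: for every $\theta\in B_1(C_1)$, $\ell_\tau(Y,X^\top\theta)\in[0,C]$ almost surely for $(Y,X)\sim\mathbf{P}$. Let $\lambda=n/\max(2K,C)$ and $\varsigma=(C_{\rm x}n\sqrt d)^{-1}$, and assume $1\le s^*<n<d$ and $\|\theta^*\|_1\le C_1-2d\varsigma$. Put $$\tilde\delta=\frac{s^*\log(n\sqrt d/s^* )}{n}.$$ Then $$\mathbb{E}\,\mathbb{E}_{\theta\sim\hat\rho_\lambda}[R(\theta)]-R^*\le\mathcal{C}_2\,\tilde\delta,$$ and, for every $\varepsilon\in(0,1)$, with probability at least $1-\varepsilon$ (over the sample), $$\mathbb{E}_{\theta\sim\hat\rho_\lambda}[R(\theta)]-R^*\le\mathc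al{C}_2'\left[\tilde\delta+\frac{\log(2/\varepsilon)}{n}\right].$$
   Context: Quantile loss: $\ell_\tau(y,x)=(y-x)(\tau-\mathbf{1}_{\{y\le x\}})$ for $y,x\in\mathbb{R}$. Quantile risk: $R(\theta)=\mathbb{E}_{(Y,X)\sim\mathbf{P}}[\ell_\tau(Y,X^\top\theta)]$, $\theta\in\mathbb{R}^d$. Empirical risk: $r_n(\theta)=\frac1n\sum_{i=1}^n\ell_\tau(Y_i,X_i^\top\theta)$. $\|\cdot\|$ is the Euclidean norm, $\|\cdot\|_1$ the $\ell_1$-norm, $\|\theta\|_0$ the number of nonzero entries of $\theta$. $B_1(C_1)=\{\theta\in\mathbb{R}^d:\|\theta\|_1\le C_1\}$. The prior $\pi$ is the probability measure on $B_1(C_1)$ with Lebesgue density $\pi(\theta)\propto\prod_{i=1}^d(\varsigma^2+\theta_i^2)^{-2}$ on $B_1(C_1)$ (and zero outside), where $\varsigma>0$. For $\lambda>0$ the Gibbs posterior $\hat\rho_\lambda$ is the (data-dependent) probability measure $\hat\rho_\lambda({\rm d}\theta)=\frac{\exp[-\lambda r_n(\theta)]}{\int\exp[-\lambda r_n]\,{\rm d}\pi}\,\pi({\rm d}\theta)$. The outer expectation $\mathbb{E}$ is over the sample $(Y_i,X_i)_{i\le n}$. *)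

(* Defs.v *)
From HB Require Import structures.
From mathcomp Require Import all_boot all_order all_algebra.
From mathcomp Require Import all_classical all_reals all_analysis.
From mathcomp Require Import measurable_realfun.

Set Implicit Arguments.
Unset Strict Implicit.
Unset Printing Implicit Defensive.

Import Order.TTheory GRing.Theory Num.Theory.
Import numFieldNormedType.Exports.

Local Open Scope classical_set_scope.
Local Open Scope ring_scope.

(* The space R^d is d.-tuple R: its measurable sets are those of the product
   sigma-algebra, which is the Borel sigma-algebra of R^d. *)
Section vectors.
Context {R : realType} {d : nat}.
Implicit Types u v : d.-tuple R.

Definition dotp u v : R := \sum_(i < d) tnth u i * tnth v i.

Definition vec_sub u v : d.-tuple R := [tuple tnth u i - tnth v i | i < d].

Definition l2norm u : R := Num.sqrt (\sum_(i < d) tnth u i ^+ 2).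

Definition l1norm u : R := \sum_(i < d) `|tnth u i|.

Definition l0norm u : nat := #|[pred i : 'I_d | tnth u i != 0]|.

Definition ball1 (r : R) : set (d.-tuple R) := [set u | l1norm u <= r].

Lemma measurable_ball1 r : measurable (ball1 r).
Proof.
rewrite -[X in measurable X]setTI.
apply: (@measurable_fun_le _ _ _ setT l1norm (cst r)) => //.
apply: measurable_sum => i; apply: measurableT_comp => //.
exact: measurable_tnth.
Qed.

Lemma measurable_dotp u : measurable_fun setT (dotp u).
Proof.
by apply: measurable_sum => i; apply: measurable_funM => //; exact: measurable_tnth.
Qed.

End vectors.

Section lebesgue_tuple.
Context {R : realType}.

Definition tuple_of_pair d (p : R * d.-tuple R) : d.+1.-tuple R :=
  [tuple of p.1 :: p.2].

Lemma measurable_tuple_of_pair d : measurable_fun setT (@tuple_of_pair d).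
Proof.
have := @measurable_cons _ _ (R * d.-tuple R)%type R fst d snd.
by apply; [exact: measurable_fst | exact: measurable_snd].
Qed.

Section step.
Variables (d : nat) (m : {sigma_finite_measure set (d.-tuple R) -> \bar R}).

Definition lebesgue_cons : set (d.+1.-tuple R) -> \bar R :=
  pushforward (lebesgue_measure \x m)%E (@tuple_of_pair d).

Let lebesgue_cons0 : lebesgue_cons set0 = 0%E.
Proof. by rewrite /lebesgue_cons /pushforward preimage_set0 measure0. Qed.

Let lebesgue_cons_ge0 A : (0 <= lebesgue_cons A)%E.
Proof. exact: (measure_ge0 (lebesgue_measure \x m)%E). Qed.

Let lebesgue_cons_sigma_additive : semi_sigma_additive lebesgue_cons.
Proof.
move=> F mF tF mUF; rewrite /lebesgue_cons /pushforward preimage_bigcup.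
have mpre B : measurable B -> measurable (@tuple_of_pair d @^-1` B).
  by move=> mB; rewrite -[X in measurable X]setTI; exact: measurable_tuple_of_pair.
apply: measure_semi_sigma_additive => [n||].
- exact: mpre.
- apply/trivIsetP => /= i j _ _ ij; rewrite -preimage_setI.
  by move/trivIsetP : tF => /(_ _ _ _ _ ij) ->//; rewrite preimage_set0.
- by rewrite -preimage_bigcup; exact: mpre.
Qed.

HB.instance Definition _ := isMeasure.Build _ _ _ lebesgue_cons
  lebesgue_cons0 lebesgue_cons_ge0 lebesgue_cons_sigma_additive.

Let lebesgue_cons_sigma_finite : sigma_finite setT lebesgue_cons.
Proof.
have /sigma_finiteP[F [TF ndF Foo]] := sigma_finiteT (@lebesgue_measure R).
have /sigma_finiteP[G [TG ndG Goo]] := sigma_finiteT m.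
pose g (u : d.+1.-tuple R) := (thead u, [tuple of behead u]).
have mg : measurable_fun setT g.
  apply/measurable_fun_pairP; split => /=.
    exact: measurable_tnth.
  exact: measurable_behead.
have gK : cancel (@tuple_of_pair d) g.
  by case=> x u; rewrite /g /tuple_of_pair /thead/=; congr pair; apply: val_inj.
exists (fun k => g @^-1` (F k `*` G k)).
  rewrite -preimage_bigcup -(preimage_setT g); congr (_ @^-1` _).
  apply/esym/seteqP; split => // -[x u] _.
  have [i _ Fx] : (\bigcup_i F i) x by rewrite -TF.
  have [j _ Gu] : (\bigcup_i G i) u by rewrite -TG.
  exists (maxn i j) => //; split => /=.
  - by move: x Fx; exact/subsetPset/ndF/leq_maxl.
  - by move: u Gu; exact/subsetPset/ndG/leq_maxr.
move=> k; have [mFk Fkoo] := Foo k; have [mGk Gkoo] := Goo k; split.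
  by rewrite -[X in measurable X]setTI; apply: mg => //; exact: measurableX.
rewrite /lebesgue_cons /pushforward -comp_preimage.
rewrite (_ : g \o _ = id); last by apply/funext => x; exact: gK.
by rewrite preimage_id product_measure1E// lte_mul_pinfty// ge0_fin_numE.
Qed.

HB.instance Definition _ := Measure_isSigmaFinite.Build _ _ _
  lebesgue_cons lebesgue_cons_sigma_finite.

End step.

(* Lebesgue measure on R^d, as the d-fold product of the Lebesgue measure on R;
   R^0 is a point of mass 1. *)
Fixpoint lebesgue_tuple (d : nat) :
    {sigma_finite_measure set (d.-tuple R) -> \bar R} :=
  match d with
  | 0 => \d_[tuple]
  | d'.+1 => lebesgue_cons (lebesgue_tuple d')
  end.

Lemma lebesgue_tuple_box d (A : 'I_d -> set R) :
  (forall i, measurable (A i)) ->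
  (lebesgue_tuple d [set u | forall i, A i (tnth u i)] =
   \prod_(i < d) lebesgue_measure (A i))%E.
Proof.
elim: d A => [|d IHd] A mA.
  by rewrite big_ord0 /= diracE mem_set// => -[].
rewrite big_ord_recl -IHd//=.
have mB : measurable [set u : d.-tuple R | forall i, A (lift ord0 i) (tnth u i)].
  rewrite (_ : mkset _ = \bigcap_(i in [set: 'I_d])
      ((@tnth d R)^~ i @^-1` A (lift ord0 i))); last first.
    by apply/seteqP; split => [u/= Au i _|u/= Au i]; exact: Au.
  apply: fin_bigcap_measurable => // i _.
  by rewrite -[X in measurable X]setTI; exact: measurable_tnth.
rewrite -product_measure1E// /lebesgue_cons /pushforward.
  congr (product_measure1 _ _ _).
  apply/seteqP; split => [[x u]/= Axu|[x u]/= [Ax Au] i].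
    split; first exact: (Axu ord0).
    by move=> i; have := Axu (lift ord0 i); rewrite tnthS.
  by have [j ->|->//] := unliftP ord0 i; rewrite tnthS.
exact: (mA ord0).
Qed.

End lebesgue_tuple.

Section with_density.
Context {disp : measure_display} {T : measurableType disp} {R : realType}.
Variables (mu : {measure set T -> \bar R}) (f : T -> R).

(* The proofs mf and f0 are not used in the value: they are arguments so that
   the measure structure can be inferred. *)
Definition with_density (mf : measurable_fun setT f) (f0 : forall x, 0 <= f x)
    (A : set T) : \bar R :=
  (\int[mu]_(x in A) (f x)%:E)%E.

Hypothesis mf : measurable_fun setT f.
Hypothesis f0 : forall x, 0 <= f x.

Let with_density0 : with_density mf f0 set0 = 0%E.
Proof. by rewrite /with_density integral_set0. Qed.

Let with_density_ge0 A : (0 <= with_density mf f0 A)%E.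
Proof. by apply: integral_ge0 => x _; rewrite lee_fin. Qed.

Let with_density_sigma_additive : semi_sigma_additive (with_density mf f0).
Proof.
apply: semi_sigma_additive_nng_induced => [|x]; last by rewrite lee_fin.
exact/measurable_EFinP.
Qed.

HB.instance Definition _ := isMeasure.Build _ _ _ (with_density mf f0)
  with_density0 with_density_ge0 with_density_sigma_additive.

End with_density.

Section quantile_regression.
Context {R : realType}.

Definition quantile_loss (tau y x : R) : R := (y - x) * (tau - (y <= x)%R%:R).

Context {d : nat}.
Implicit Types (theta : d.-tuple R) (z : R * d.-tuple R).

(* A pair z = (y, x) is a response y with its covariate vector x. *)
Definition pair_loss (tau : R) theta z : R :=
  quantile_loss tau z.1 (dotp z.2 theta).

(* The loss is nonnegative for 0 < tau < 1, so the extended real-valued integral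
   is the expectation of the loss, finite or not. *)
Definition risk (tau : R) (P : probability (R * d.-tuple R)%type R) theta
    : \bar R :=
  (\int[P]_z (pair_loss tau theta z)%:E)%E.

Definition is_argmin_risk (tau : R) P theta :=
  forall theta', (risk tau P theta <= risk tau P theta')%E.

Definition empirical_risk (tau : R) (n : nat) (s : 'I_n -> R * d.-tuple R)
    theta : R :=
  n%:R^-1 * \sum_(i < n) pair_loss tau theta (s i).

Definition prior_weight (C1 vsig : R) theta : R :=
  \1_(ball1 C1) theta * \prod_(i < d) (vsig ^+ 2 + tnth theta i ^+ 2) ^- 2.

Lemma measurable_prior_weight C1 vsig :
  measurable_fun setT (prior_weight C1 vsig).
Proof.
apply: measurable_funM; first by apply: measurable_indic; exact: measurable_ball1.
apply: measurable_prod => i _.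
have -> : (fun u : d.-tuple R => (vsig ^+ 2 + tnth u i ^+ 2) ^- 2) =
    (fun u => (vsig ^+ 2 + tnth u i ^+ 2) `^ (1 *- 2)).
  by apply/funext => u; rewrite powR_invn// addr_ge0// sqr_ge0.
apply: (@measurableT_comp _ _ _ _ _ _ (fun x : R => x `^ _)).
  exact: measurable_powR.
apply: measurable_funD => //; apply: measurable_funX; exact: measurable_tnth.
Qed.

Lemma prior_weight_ge0 C1 vsig theta : 0 <= prior_weight C1 vsig theta.
Proof.
rewrite mulr_ge0// prodr_ge0// => i _.
by rewrite invr_ge0 exprn_ge0// addr_ge0// sqr_ge0.
Qed.

(* The Dirac mass is the default value of mnormalize, taken only if the total
   mass of the weight is 0 or +oo. This does not happen for 0 < C1 and
   0 < vsig: the weight is positive on the ball, which has positive measure, and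
   bounded there, and the ball has finite measure. *)
Definition prior (C1 vsig : R) : probability (d.-tuple R) R :=
  mnormalize (with_density (lebesgue_tuple d)
    (measurable_prior_weight C1 vsig) (prior_weight_ge0 C1 vsig))
    (@dirac _ (d.-tuple R) [tuple of nseq d 0] R).

Definition gibbs_weight (tau lambda : R) (n : nat) (s : 'I_n -> R * d.-tuple R)
    theta : R :=
  expR (- lambda * empirical_risk tau s theta).

Lemma measurable_gibbs_weight tau lambda n (s : 'I_n -> R * d.-tuple R) :
  measurable_fun setT (gibbs_weight tau lambda s).
Proof.
apply: measurableT_comp => //; apply: measurable_funM => //.
apply: measurable_funM => //; apply: measurable_sum => i.
have mdot := measurable_dotp (s i).2.
apply: measurable_funM; first exact: measurable_funB.
apply: measurable_funB => //.
rewrite (_ : (fun _ => _) =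
    (fun u => if (s i).1 <= dotp (s i).2 u then 1 else 0 : R)); last first.
  by apply/funext => u; case: ifP.
apply: measurable_fun_ifT => //; exact: measurable_fun_ler.
Qed.

Lemma gibbs_weight_ge0 tau lambda n (s : 'I_n -> R * d.-tuple R) theta :
  0 <= gibbs_weight tau lambda s theta.
Proof. exact: expR_ge0. Qed.

(* Here too the default value of mnormalize is not reached: the weight is
   positive and, for 0 < tau < 1 and 0 <= lambda, at most 1. *)
Definition gibbs_posterior (tau lambda : R) (pi : probability (d.-tuple R) R)
    (n : nat) (s : 'I_n -> R * d.-tuple R) : probability (d.-tuple R) R :=
  mnormalize (with_density pi
    (measurable_gibbs_weight tau lambda s) (gibbs_weight_ge0 tau lambda s)) pi.

End quantile_regression.

Section iid.
Context {disp disp' : measure_display} {Omega : measurableType disp}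
  {T : measurableType disp'} {R : realType}.

Definition mutually_independent (Pr : probability Omega R) (n : nat)
    (Z : 'I_n -> {RV Pr >-> T}) : Prop :=
  forall (J : {set 'I_n}) (A : 'I_n -> set T), (forall i, measurable (A i)) ->
    (Pr (\bigcap_(i in [set` J]) (Z i @^-1` A i)) =
     \prod_(i in J) Pr (Z i @^-1` A i))%E.

Definition iid_sample (Pr : probability Omega R) (n : nat)
    (Z : 'I_n -> {RV Pr >-> T}) (P : probability T R) : Prop :=
  (forall i A, measurable A -> distribution Pr (Z i) A = P A) /\
  mutually_independent Z.

End iid.

(* Main.v *)
Require Import Defs.
From HB Require Import structures.
From mathcomp Require Import all_boot all_order all_algebra.
From mathcomp Require Import all_classical all_reals all_analysis.
From mathcomp Require Import measurable_realfun ring lra.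


(* Write [M = max (2 K) C], [lambda = n / M], [h theta] for the excess risk and
   [L theta] for [lambda] times the excess empirical risk. The elementary bound
   [exp x <= 1 + x + 3/2 x^2] on [[-1, 1]], the Bernstein condition and
   independence give, for [theta] in the l1-ball, [E exp (- L theta) <=
   exp (- lambda/4 * h theta)] and [E exp (L theta) <= exp (7/4 lambda h theta)].
   Let [Z] be the integral of [exp (- L)] under the prior and [g] the posterior
   mean of [h]. Jensen's inequality and Fubini turn the first bound into
   [E (exp (lambda/4 * g) Z) <= 1]; the second one bounds [E (1 / Z)] by the
   inverse of the prior mass of the set of [theta] at Euclidean distance at most
   [2 sqrt d * vsig] of [thetas], on which [h <= 2 / n]. By Cauchy-Schwarz
   [E exp (lambda/8 * g)] is controlled, which yields both claims. The prior mass
   is bounded below by comparison with the Student density translated to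
   [thetas], which costs the factor [prod_i (1 + |thetas_i| / vsig)^-4]. *)

Set Implicit Arguments.
Unset Strict Implicit.
Unset Printing Implicit Defensive.

Import Order.TTheory GRing.Theory Num.Theory.
Import numFieldNormedType.Exports.

Local Open Scope classical_set_scope.
Local Open Scope ring_scope.

(** * Elementary inequalities *)

(** Sparsity enters only through the cost of translating the prior: a coordinate where [thetas]
    vanishes contributes a factor 1 to the product, and the arithmetic-geometric mean inequality on
    the remaining ones leaves the exponent [s] instead of [d]. The logarithm of this cost is the
    main term of the rate. Signed integrals are avoided throughout. Each inequality between
    integrands has its negative terms moved to the other side, so that Tonelli's theorem and
    additivity for non-negative functions suffice. For the same reason Jensen and Cauchy-Schwarz
    appear as pointwise bounds, a tangent line for the former and [2 x y <= c x^2 + y^2 / c] for the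
    latter, with the free constant chosen so that nothing is lost after integration. The boundedness
    and Bernstein assumptions concern the l1-ball only. The excess risk is therefore cut off outside
    it, and statements about parameters hold almost everywhere for the prior, which does not charge
    the complement. *)

Lemma expR_le_quadratic (R : realType) (x : R) : `|x| <= 1 ->
  expR x <= 1 + x + 3 / 2 * x ^+ 2.
Proof.
rewrite ler_norml => /andP[xl xu].
(* Only [1 + t <= exp t] is used, at [t = - x / 4]. The fourth power of [exp y <= 1 / (1 - y)] is
   still below the quadratic with coefficient 3/2 on the interval. *)
pose y := x / 4.
have e1 : 1 - y <= expR (- y) by have := expR_ge1Dx (- y).
have y1 : 0 < 1 - y by rewrite /y; lra.
have e4 : expR x <= (1 - y) ^- 4.
  have -> : x = (- (- y)) * 4%:R by rewrite /y; field.
  rewrite expRM_natr expRN -exprVn lerXn2r ?nnegrE ?invr_ge0 ?expR_ge0 ?(ltW y1)//.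
  by rewrite lef_pV2 ?posrE ?expR_gt0.
apply: (le_trans e4).
rewrite -[leLHS]mul1r ler_pdivrMr ?exprn_gt0//.
have -> : x = 4 * y by rewrite /y; field.
have yl : - (1/4) <= y by rewrite /y; lra.
have yu : y <= 1/4 by rewrite /y; lra.
have -> : 1 + 4 * y + 3 / 2 * (4 * y) ^+ 2 = 1 + 4 * y + 24 * y ^+ 2 by field.
(* This quartic is the quotient of [(1 + 4 * y + 24 * y ^+ 2) * (1 - y) ^+ 4 - 1] by [y ^+ 2]. *)
have p0 : 0 <= 14 - 76 * y + 129 * y ^+ 2 - 92 * y ^+ 3 + 24 * y ^+ 4.
  have [y0|y0] := leP 0 y.
    have : 0 <= y ^+ 2 * (1/4 - y) by rewrite mulr_ge0 ?sqr_ge0// subr_ge0.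
    have : 0 <= y ^+ 4 by rewrite exprn_ge0.
    rewrite !exprS expr0; nra.
  have : 0 <= (- y) ^+ 3 by rewrite exprn_ge0// oppr_ge0 ltW.
  have : 0 <= (- y) ^+ 4 by rewrite exprn_ge0// oppr_ge0 ltW.
  have := sqr_ge0 y.
  rewrite !exprS expr0; nra.
have := mulr_ge0 (sqr_ge0 y) p0.
rewrite !exprS expr0; nra.
Qed.

Lemma quantile_loss_lip (R : realType) (tau y x x' : R) : 0 < tau < 1 ->
  `|quantile_loss tau y x - quantile_loss tau y x'| <= `|x - x'|.
Proof.
move=> /andP[t0 t1]; rewrite /quantile_loss ler_norml.
have := ler_norm (x - x'); have := ler_norm (x' - x); rewrite distrC.
set a := `|_ - _|.
move=> h1 h2.
case: (leP y x) => yx; case: (leP y x') => yx'; rewrite ?mulr1n ?mulr0n /=; apply/andP; split; nra.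
Qed.

Lemma quantile_loss_ge0 (R : realType) (tau y x : R) : 0 < tau < 1 ->
  0 <= quantile_loss tau y x.
Proof.
move=> /andP[t0 t1]; rewrite /quantile_loss; case: (leP y x) => yx.
  rewrite /= ?mulr1n; have : 0 <= (x - y) * (1 - tau).
    by rewrite mulr_ge0 ?subr_ge0 ?(ltW t1).
  lra.
by rewrite /= ?mulr0n subr0 mulr_ge0 ?subr_ge0 ?(ltW t0) ?(ltW yx).
Qed.

Lemma cauchy_schwarz_sum (R : realType) n (a b : 'I_n -> R) :
  (\sum_i a i * b i) ^+ 2 <= (\sum_i a i ^+ 2) * (\sum_i b i ^+ 2).
Proof.
set A := \sum_i a i ^+ 2; set B := \sum_i b i ^+ 2; set S := \sum_i _.
have A0 : 0 <= A by apply: sumr_ge0 => i _; exact: sqr_ge0.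
have : 0 <= \sum_i (A * b i - S * a i) ^+ 2.
  by apply: sumr_ge0 => i _; exact: sqr_ge0.
have -> : \sum_i (A * b i - S * a i) ^+ 2 = A * (A * B - S ^+ 2).
  transitivity (\sum_i (A ^+ 2 * b i ^+ 2 - 2 * A * S * (a i * b i) + S ^+ 2 * a i ^+ 2)).
    by apply: eq_bigr => i _; ring.
  rewrite !big_split/= sumrN -!mulr_sumr -/A -/B -/S; ring.
have [A1|A1] := eqVneq A 0; last by rewrite pmulr_rge0 ?lt0r ?A1// subr_ge0.
have a0 i : a i = 0.
  apply/eqP; rewrite -sqrf_eq0; apply/eqP.
  by move/eqP: A1; rewrite psumr_eq0 => [/allP/(_ i (mem_index_enum _))/eqP|j _]; last exact: sqr_ge0.
move=> _; rewrite A1 mul0r (_ : S = 0); first by rewrite expr0n/= lexx.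
by rewrite /S big1// => i _; rewrite a0 mul0r.
Qed.

(** * Integration with respect to densities and independence *)

Section transfer.
Local Open Scope ereal_scope.
Import HBNNSimple.

(** Serves twice: with [g] the identity, [H] is a density; in the independence argument [g] is one
    observation and [H] the product of the factors in the others. The identity on sets extends to
    simple functions by linearity and to [f] by monotone convergence. *)
Lemma ge0_integral_weighted_pushforward d1 d2 (S : measurableType d1)
    (T : measurableType d2) (R : realType) (m : {measure set S -> \bar R})
    (nu : {measure set T -> \bar R}) (g : S -> T) (H : S -> R) :
  measurable_fun setT g -> measurable_fun setT H -> (forall w, (0 <= H w)%R) ->
  (forall A, measurable A -> nu A = \int[m]_w (H w * \1_A (g w))%:E) ->
  forall f : T -> \bar R, measurable_fun setT f -> (forall x, 0 <= f x) ->
    \int[nu]_x f x = \int[m]_w ((H w)%:E * f (g w)).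
Proof.
move=> mg mH H0 nuE f mf f0.
pose f_ := nnsfun_approx measurableT mf.
have mfg n : measurable_fun setT (f_ n \o g) by exact: measurableT_comp.
transitivity (limn (fun n => \int[nu]_x (f_ n x)%:E)).
  rewrite -monotone_convergence//.
  - by apply: eq_integral => y _; apply/esym/cvg_lim => //; exact: cvg_nnsfun_approx.
  - by move=> n; exact/measurable_EFinP/measurable_funP.
  - by move=> n y _; rewrite lee_fin.
  - by move=> y _ i j ij; rewrite lee_fin; exact/lefP/nd_nnsfun_approx.
rewrite [X in limn X](_ : _ = (fun n => \int[m]_w (H w * f_ n (g w))%:E)).
  rewrite -monotone_convergence//.
  - apply: eq_integral => w _; apply/cvg_lim => //.
    under eq_fun do rewrite EFinM.
    by apply: cvgeZl; last exact: cvg_nnsfun_approx.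
  - by move=> n; apply/measurable_EFinP/measurable_funM => //; exact: mfg.
  - by move=> n x _; rewrite lee_fin mulr_ge0.
  - move=> x _ i j ij; rewrite lee_fin ler_wpM2l//.
    exact/lefP/nd_nnsfun_approx.
apply/funext => n.
have mind r : measurable_fun setT (fun w => \1_(f_ n @^-1` [set r]) (g w) : R).
  by apply: measurableT_comp.
have fE x : f_ n x = (\sum_(r \in range (f_ n)) r * \1_(f_ n @^-1` [set r]) x)%R.
  exact: fimfunE.
have f_ge0 r x : (0 <= r * \1_(f_ n @^-1` [set r]) x)%R.
  exact: nnfun_muleindic_ge0.
under eq_integral do rewrite fE -fsumEFin//.
rewrite ge0_integral_fsum//; last 2 first.
- by move=> r; exact/measurable_EFinP/measurable_funM.
- by move=> r x _; rewrite lee_fin.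
transitivity (\sum_(r \in range (f_ n))
    \int[m]_w (H w * (r * \1_(f_ n @^-1` [set r]) (g w)))%:E).
  apply: eq_fsbigr => r; rewrite inE => -[/= x _ <-].
  under eq_integral do rewrite EFinM.
  rewrite ge0_integralZl_EFin//; last exact/measurable_EFinP.
  rewrite integral_indic// setIT nuE//.
  rewrite -ge0_integralZl_EFin//.
  - by apply: eq_integral => w _; rewrite -EFinM mulrCA.
  - by move=> w _; rewrite lee_fin mulr_ge0.
  - exact/measurable_EFinP/measurable_funM.
rewrite -ge0_integral_fsum//.
- apply: eq_integral => w _; rewrite fsumEFin// fE; congr (_%:E).
  by rewrite mulr_fsumr.
- move=> r; apply/measurable_EFinP/measurable_funM => //.
  exact: measurable_funM.
- by move=> r w _; rewrite lee_fin mulr_ge0.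
Qed.

Lemma ge0_integral_with_density d (T : measurableType d) (R : realType)
    (mu : {measure set T -> \bar R}) (w : T -> R) (mw : measurable_fun setT w)
    (w0 : forall x, (0 <= w x)%R) (f : T -> \bar R) :
  measurable_fun setT f -> (forall x, 0 <= f x) ->
  \int[with_density mu mw w0]_x f x = \int[mu]_x ((w x)%:E * f x).
Proof.
move=> mf f0; apply: (@ge0_integral_weighted_pushforward _ _ _ _ _ _ _ id) => //.
move=> A mA; rewrite /= /with_density [LHS]integral_mkcond; apply: eq_integral => x _.
rewrite /patch indicE; case: ifPn => _; first by rewrite mulr1.
by rewrite mulr0.
Qed.

Lemma ge0_integral_mnormalize d (T : measurableType d) (R : realType)
    (mu : {measure set T -> \bar R}) (P : probability T R) (f : T -> \bar R) :
  measurable_fun setT f -> (forall x, 0 <= f x) ->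
  mu setT != 0 -> mu setT != +oo ->
  \int[mnormalize mu P]_x f x = (fine (mu setT))^-1%:E * \int[mu]_x f x.
Proof.
move=> mf f0 mu0 muoo.
have c0 : (0 <= (fine (mu setT))^-1)%R by rewrite invr_ge0 fine_ge0.
rewrite [LHS](eq_measure_integral (mscale (NngNum c0) mu)).
  by rewrite ge0_integral_mscale//.
move=> A mA _; rewrite /= /mnormalize/= (negbTE mu0) (negbTE muoo)/=.
by rewrite /mscale/= muleC.
Qed.

End transfer.

Section independence.
Context d d' (Omega : measurableType d) (T : measurableType d') (R : realType).
Variables (Pr : probability Omega R) (n : nat) (Z : 'I_n -> {RV Pr >-> T}).
Local Open Scope ereal_scope.

(** Independence is given for events only, so the induction is on the number of factors not known to
    be indicators. Replacing one such [G j] by an indicator brings the product under the induction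
    hypothesis; letting the set vary identifies a measure, against which [G j] is then
    integrated. *)
Lemma ge0_expectation_prod (F : 'I_n -> T -> R) : mutually_independent Z ->
  (forall i, measurable_fun setT (F i)) -> (forall i x, (0 <= F i x)%R) ->
  (forall i, \int[Pr]_w (F i (Z i w))%:E < +oo) ->
  \int[Pr]_w (\prod_i F i (Z i w))%:E = \prod_i \int[Pr]_w (F i (Z i w))%:E.
Proof.
move=> indep mF F0 Foo.
suff main (k : nat) (J : {set 'I_n}) (G : 'I_n -> T -> R) : #|J| = k ->
    (forall i, measurable_fun setT (G i)) -> (forall i x, (0 <= G i x)%R) ->
    (forall i, \int[Pr]_w (G i (Z i w))%:E < +oo) ->
    (forall i, i \notin J -> exists2 A, measurable A & G i = \1_A) ->
    \int[Pr]_w (\prod_i G i (Z i w))%:E = \prod_i \int[Pr]_w (G i (Z i w))%:E.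
  by apply: (main _ finset.setT) => // i; rewrite finset.inE.
elim: k J G => [|k IHk] J G Jk mG G0 Goo GJ.
  have /choice[A AG] : forall i, exists A, measurable A /\ G i = \1_A.
    move: Jk => /eqP; rewrite cards_eq0 => /eqP J0 i.
    by have [|A mA GA] := GJ i; [rewrite J0 inE|exists A].
  have mZ i : measurable (Z i @^-1` A i).
    by rewrite -[X in measurable X]setTI; apply: measurable_funP => //; case: (AG i).
  have mA i : measurable (A i) by case: (AG i).
  have := indep finset.setT A mA.
  under eq_bigl do rewrite inE.
  under [in X in _ -> _ = X]eq_bigr => i _.
    rewrite (eq_integral (fun w => (\1_(Z i @^-1` A i) w)%:E)); last first.
      by move=> w _; case: (AG i) => _ ->.
    rewrite integral_indic// setIT.
    over.
  move=> <-; rewrite -[X in Pr X]setIT -integral_indic//; last first.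
    by apply: fin_bigcap_measurable.
  apply: eq_integral => w _; congr (_%:E).
  rewrite [RHS]indicE; case: (boolP (w \in _)) => [|/negP]; rewrite inE/= => wA.
    apply: big1 => i _; have [_ ->] := AG i.
    by rewrite indicE mem_set//; apply: wA => /=; rewrite inE.
  apply/eqP; rewrite prodf_seq_eq0; apply/hasP.
  have /existsNP[i /not_implyP[_ Ai]] := wA.
  exists i; first by rewrite mem_index_enum.
  by have [_ ->] := AG i; rewrite indicE memNset//= eqxx.
have /card_gt0P[j jJ] : (0 < #|J|)%N by rewrite Jk.
pose G' (g : T -> R) i := if i == j then g else G i.
have mG' g : measurable_fun setT g -> forall i, measurable_fun setT (G' g i).
  by move=> mg i; rewrite /G'; case: ifP.
have prodG' g w : (\prod_i G' g i (Z i w) =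
    (\prod_(i | i != j) G i (Z i w)) * g (Z j w))%R.
  rewrite (bigD1 j)//= mulrC /G' eqxx; congr (_ * _)%R.
  by apply: eq_bigr => i /negbTE ->.
have prodI g : \prod_i (\int[Pr]_w (G' g i (Z i w))%:E) =
    (\prod_(i | i != j) \int[Pr]_w (G i (Z i w))%:E) *
    \int[Pr]_w (g (Z j w))%:E.
  rewrite (bigD1 j)//= muleC {2}/G' eqxx; congr (_ * _).
  by apply: eq_bigr => i /negbTE ij; rewrite /G' ij.
have GE : G = G' (G j).
  by apply/funext => i; rewrite /G'; case: eqP => [->|].
have IG0 i : 0 <= \int[Pr]_w (G i (Z i w))%:E.
  by apply: integral_ge0 => w _; rewrite lee_fin.
set c := \prod_(i | i != j) \int[Pr]_w (G i (Z i w))%:E in prodI.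
have cfin : c \is a fin_num.
  by apply: prode_fin_num => i _; rewrite ge0_fin_numE.
have c0 : (0 <= fine c)%R by rewrite fine_ge0// prode_ge0.
pose H w := (\prod_(i | i != j) G i (Z i w))%R.
have mH : measurable_fun setT H.
  rewrite /H; under eq_fun do rewrite big_mkcond/=.
  by apply: measurable_prod => i _; case: (i != j) => //; exact: measurableT_comp.
have H0 w : (0 <= H w)%R by apply: prodr_ge0.
(* The law of [Z j] scaled by the product of the other expectations; their finiteness makes this
   product a real scale. *)
pose nu := mscale (NngNum c0) (distribution Pr (Z j)).
have nuE A : measurable A -> nu A = \int[Pr]_w (H w * \1_A (Z j w))%:E.
  move=> mA; pose g : T -> R := \1_A.
  have mg : measurable_fun setT g by exact: measurable_indic.
  have gE : \int[Pr]_w (g (Z j w))%:E = Pr (Z j @^-1` A).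
    transitivity (\int[Pr]_w (\1_(Z j @^-1` A) w)%:E); first exact: eq_integral.
    rewrite integral_indic ?setIT//.
    by rewrite -[X in measurable X]setTI; exact: measurable_funP.
  have Jk' : #|J :\ j| = k by move: Jk; rewrite (cardsD1 j) jJ add1n => -[].
  have g0 i x : (0 <= G' g i x)%R by rewrite /G'; case: ifP.
  have goo i : \int[Pr]_w (G' g i (Z i w))%:E < +oo.
    rewrite /G'; case: eqP => [->|//]; rewrite gE.
    rewrite (le_lt_trans (probability_le1 _ _)) ?ltry//.
    by rewrite -[X in measurable X]setTI; exact: measurable_funP.
  have gJ i : i \notin J :\ j -> exists2 B, measurable B & G' g i = \1_B.
    rewrite !inE negb_and negbK /G'; case: eqP => [_ _|_ /= iJ]; last exact: GJ.
    by exists A.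
  have := IHk _ _ Jk' (mG' _ mg) g0 goo gJ.
  rewrite prodI gE => E; transitivity (c * Pr (Z j @^-1` A)); first by rewrite /nu /mscale/= fineK.
  rewrite -E.
  by apply: eq_integral => w _; rewrite prodG'.
rewrite GE prodI.
have mGj : measurable_fun setT (EFin \o G j) by exact/measurable_EFinP.
have Gj0 x : 0 <= (EFin \o G j) x by rewrite lee_fin.
have E := ge0_integral_weighted_pushforward (measurable_funP (Z j)) mH H0 nuE mGj Gj0.
transitivity (\int[Pr]_w ((H w)%:E * (EFin \o G j) (Z j w))).
  by apply: eq_integral => w _; rewrite prodG'.
transitivity (\int[nu]_x (EFin \o G j) x); first by rewrite E.
rewrite ge0_integral_mscale// -[X in X * _]/((fine c)%:E) fineK//; congr (_ * _).
by rewrite ge0_integral_pushforward.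
Qed.

End independence.

(** * The prior mass of a Euclidean ball *)

Section lebesgue_tuple_integral.
Context {R : realType}.
Local Open Scope ereal_scope.

Lemma ge0_integral_lebesgue_cons d (f : d.+1.-tuple R -> \bar R) :
  measurable_fun setT f -> (forall u, 0 <= f u) ->
  \int[lebesgue_tuple d.+1]_u f u =
  \int[lebesgue_measure]_x \int[lebesgue_tuple d]_u f [tuple of x :: u].
Proof.
move=> mf f0.
have mt := @measurable_tuple_of_pair R d.
transitivity (\int[pushforward (lebesgue_measure \x lebesgue_tuple d)
    (@tuple_of_pair R d)]_u f u).
  exact: eq_measure_integral.
rewrite ge0_integral_pushforward// preimage_setT fubini_tonelli1//=.
exact: measurableT_comp.
Qed.

Lemma ge0_integral_lebesgue_prod d (h : 'I_d -> R -> R) :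
  (forall i, measurable_fun setT (h i)) -> (forall i x, (0 <= h i x)%R) ->
  \int[lebesgue_tuple d]_u (\prod_i h i (tnth u i))%:E =
  \prod_i \int[lebesgue_measure]_x (h i x)%:E.
Proof.
elim: d h => [|d IHd] h mh h0.
  rewrite big_ord0; transitivity (\int[lebesgue_tuple 0]_u cst 1 (u : 0.-tuple R)).
    by apply: eq_integral => u _; rewrite big_ord0.
  by rewrite integral_cst// mul1e /= diracE in_setT.
rewrite ge0_integral_lebesgue_cons; last 2 first.
- apply/measurable_EFinP; apply: measurable_prod => i _.
  apply: measurableT_comp => //; exact: measurable_tnth.
- by move=> u; rewrite lee_fin prodr_ge0.
rewrite big_ord_recl -IHd//.
set c := \int[lebesgue_tuple d]_u _.
have c0 : 0 <= c by apply: integral_ge0 => u _; rewrite lee_fin prodr_ge0.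
transitivity (\int[lebesgue_measure]_x ((h ord0 x)%:E * c)); last first.
  rewrite ge0_integralZr//; last by move=> x _; rewrite lee_fin.
  by apply/measurable_EFinP; exact: mh.
apply: eq_integral => x _.
rewrite -ge0_integralZl_EFin//.
- apply: eq_integral => u _; rewrite big_ord_recl -EFinM; congr (_ * _)%:E.
  by apply: eq_bigr => i _; rewrite tnthS.
- by move=> u _; rewrite lee_fin prodr_ge0.
- apply/measurable_EFinP; apply: measurable_prod => i _.
  apply: measurableT_comp => //; exact: measurable_tnth.
Qed.

End lebesgue_tuple_integral.

(** * One-dimensional Student integrals *)

Section student_integrals.
Context {R : realType}.
Local Notation mu := (@lebesgue_measure R).

Lemma ge0_integral_affine (v a : R) (g : R -> R) : 0 < v -> continuous g ->
  (forall x, 0 <= g x) ->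
  (\int[mu]_x (g ((x - a) / v))%:E = v%:E * \int[mu]_x (g x)%:E)%E.
Proof.
move=> v0 cg g0.
pose F (x : R^o) := (x - a) / v.
have F'E : F^`()%classic = cst v^-1.
  apply/funext => x; rewrite /F derive1E deriveM// deriveD// derive_cst scaler0.
  by rewrite add0r derive_id derive_cst addr0 scaler1.
rewrite [in RHS](@increasing_ge0_integration_by_substitutionT _ F)//.
- rewrite -ge0_integralZl_EFin ?(ltW v0)//=.
  + apply: eq_integral => x _; rewrite -EFinM F'E !fctE/=.
    by rewrite mulrCA mulfV ?gt_eqF// mulr1.
  + by move=> x _; rewrite F'E lee_fin mulr_ge0//= invr_ge0 ltW.
  + rewrite F'E; apply/measurable_EFinP/measurable_funM => //.
    apply: measurableT_comp; first exact: continuous_measurable_fun.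
    by apply: measurable_funM => //; exact: measurable_funD.
- by move=> x y xy; rewrite /F ltr_pM2r ?invr_gt0// ltrD2r.
- by rewrite F'E => ?; exact: cvg_cst.
- by rewrite F'E; exact: is_cvg_cst.
- by rewrite F'E; exact: is_cvg_cst.
- by apply/gt0_cvgMlNy; [rewrite invr_gt0|exact: cvg_addrr_Ny].
- by apply/gt0_cvgMly; [rewrite invr_gt0|exact: cvg_addrr].
Qed.

(* The members [c = 1] and [c = -1] of this family of probability densities (up
   to the factor [pi / 2]) are the Student density [(1 + x^2)^-2] and its second
   moment [x^2 (1 + x^2)^-2]. *)
Let f (c x : R) := ((1 + x ^+ 2) + c * (1 - x ^+ 2)) / (2 * ((1 + x ^+ 2) * (1 + x ^+ 2))).

Let F (c x : R) := (atan x + c * (x / (1 + x ^+ 2))) / 2.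

Let D0 (x : R) : 0 < 1 + x ^+ 2.
Proof. by rewrite ltr_wpDr// sqr_ge0. Qed.

Let cf c : continuous (f c).
Proof.
have cq (b : R) : continuous (fun y : R => 1 + b * y ^+ 2).
  move=> x; apply: cvgD; first exact: cvg_cst.
  by apply: cvgM; [exact: cvg_cst|exact: exprn_continuous].
have c1 := cq 1; have cN1 := cq (- 1).
rewrite (_ : f c = fun y : R => ((1 + 1 * y ^+ 2) + c * (1 + -1 * y ^+ 2)) /
    (2 * ((1 + 1 * y ^+ 2) * (1 + 1 * y ^+ 2)))); last first.
  by apply/funext => y; rewrite /f !mul1r mulN1r.
move=> x; apply: cvgM.
  by apply: cvgD; [exact: c1|apply: cvgM; [exact: cvg_cst|exact: cN1]].
apply: cvgV; first by rewrite !mul1r !mulf_neq0// gt_eqF.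
by apply: cvgM; [exact: cvg_cst|apply: cvgM; exact: c1].
Qed.

Let dF c (x : R) : is_derive x 1 (F c) (f c x).
Proof.
rewrite /F.
have D1 : is_derive x 1 (fun y : R => 1 + y ^+ 2) (2 * x).
  apply: is_derive_eq; rewrite /GRing.scale/=; ring.
have D2 := @is_deriveV _ (fun y : R => 1 + y ^+ 2) x _ 1 (lt0r_neq0 (D0 x)) D1.
have D3 := is_derive1_atan x.
apply: is_derive_eq; rewrite /GRing.scale/= /f.
have d0 := lt0r_neq0 (D0 x).
by field.
Qed.

Let Fy c : F c x @[x --> +oo] --> pi / 4.
Proof.
have -> : pi / 4 = (pi / 2 + c * 0) / 2 :> R by field.
apply: cvgM; last exact: cvg_cst.
apply: cvgD; first exact: cvgy_atan.
apply: cvgM; first exact: cvg_cst.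
have H : (x : R)^-1 @[x --> +oo] --> (0 : R).
  by apply/gtr0_cvgV0; [exact: nbhs_pinfty_gt|exact: cvg_id].
apply: (squeeze_cvgr _ (cvg_cst 0) H); near=> x.
have x0 : 0 < x by near: x; exact: nbhs_pinfty_gt.
apply/andP; split; first by rewrite divr_ge0// ltW.
rewrite ler_pdivrMr// mulrDr mulr1 expr2 mulrA mulVf ?gt_eqF// mul1r.
by rewrite lerDr invr_ge0 ltW.
Unshelve. all: end_near. Qed.

Let f_ge0 c x : -1 <= c <= 1 -> 0 <= f c x.
Proof.
move=> /andP[c0 c1]; rewrite /f divr_ge0 ?mulr_ge0 ?(ltW (D0 x))//.
by have := sqr_ge0 x; nra.
Qed.

Let mf c (v a : R) : measurable_fun setT (fun x : R => f c ((x - a) / v)).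
Proof.
apply: measurableT_comp; first exact: continuous_measurable_fun.
by apply: measurable_funM => //; exact: measurable_funD.
Qed.

(** The part of [F] proportional to [c] vanishes at 0 and at infinity, so the whole family has the
    same mass; evenness reduces the computation to the half-line. *)
Let integral_f c : -1 <= c <= 1 -> (\int[mu]_x (f c x)%:E = (pi / 2)%:E)%E.
Proof.
move=> c01.
have f0 x : 0 <= f c x by exact: f_ge0.
rewrite ge0_symfun_integralT//; last first.
  by move=> x; rewrite /f/= sqrrN.
rewrite (_ : [set x | _] = `[0, +oo[%classic); last first.
  by apply/seteqP; split => x/=; rewrite in_itv/= andbT.
rewrite (ge0_continuous_FTC2y _ _ (Fy c))//.
- by rewrite /F atan0 mul0r mulr0 addr0 mul0r sube0 -EFinM; congr (_%:E); field.
- by apply: continuous_subspaceT; exact: cf.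
- by move=> x _; have [] := dF c x.
- apply: cvg_at_right_filter; apply: differentiable_continuous.
  by apply/derivable1_diffP; have [] := dF c 0.
- by move=> x _; rewrite derive1E; have [] := dF c x.
Qed.

Lemma integral_student (v a : R) : 0 < v ->
  (\int[mu]_x ((v ^+ 2 + (x - a) ^+ 2) ^- 2)%:E = (pi / 2 * v ^- 3)%:E)%E.
Proof.
move=> v0; have vn0 : v != 0 by rewrite gt_eqF.
have c1 : -1 <= (1 : R) <= 1 by apply/andP; split; lra.
transitivity (\int[mu]_x ((v ^- 4)%:E * (f 1 ((x - a) / v))%:E))%E.
  apply: eq_integral => x _; rewrite -EFinM /f; congr (_%:E).
  have d0 : v ^+ 2 + (x - a) ^+ 2 != 0.
    by rewrite gt_eqF// ltr_wpDr ?sqr_ge0// exprn_gt0.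
  by field; rewrite vn0 d0.
rewrite ge0_integralZl_EFin//.
- rewrite ge0_integral_affine// ?integral_f//; last by move=> x; exact: f_ge0.
  by rewrite -!EFinM; congr (_%:E); field.
- by move=> x _; rewrite lee_fin f_ge0.
- by apply/measurable_EFinP; exact: mf.
- by rewrite invr_ge0 exprn_ge0// ltW.
Qed.

(** The value is [v ^+ 2] times that of [integral_student]: the normalized Student density has
    variance [v ^+ 2], which calibrates the radius used in Markov's inequality. *)
Lemma integral_student_sqr (v a : R) : 0 < v ->
  (\int[mu]_x ((x - a) ^+ 2 * (v ^+ 2 + (x - a) ^+ 2) ^- 2)%:E =
   (pi / 2 * v ^- 1)%:E)%E.
Proof.
move=> v0; have vn0 : v != 0 by rewrite gt_eqF.
have c1 : -1 <= (-1 : R) <= 1 by apply/andP; split; lra.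
transitivity (\int[mu]_x ((v ^- 2)%:E * (f (-1) ((x - a) / v))%:E))%E.
  apply: eq_integral => x _; rewrite -EFinM /f; congr (_%:E).
  have d0 : v ^+ 2 + (x - a) ^+ 2 != 0.
    by rewrite gt_eqF// ltr_wpDr ?sqr_ge0// exprn_gt0.
  by field; rewrite vn0 d0.
rewrite ge0_integralZl_EFin//.
- rewrite ge0_integral_affine// ?integral_f//; last by move=> x; exact: f_ge0.
  by rewrite -!EFinM; congr (_%:E); field.
- by move=> x _; rewrite lee_fin f_ge0.
- by apply/measurable_EFinP; exact: mf.
- by rewrite invr_ge0 exprn_ge0// ltW.
Qed.

End student_integrals.

(** * Comparison of the prior with a translated Student density *)

Section prior_mass.
Context {R : realType}.
Variables (d : nat) (v : R).
Hypothesis v0 : 0 < v.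
Implicit Types a u : d.-tuple R.

Local Notation I0 := (pi / 2 * v ^- 3 : R).

Let student_gt0 (x : R) : 0 < v ^+ 2 + x ^+ 2.
Proof. by rewrite ltr_wpDr ?sqr_ge0// exprn_gt0. Qed.

Let student a u : R := \prod_(i < d) (v ^+ 2 + (tnth u i - tnth a i) ^+ 2) ^- 2.

Let student0_ge0 (x : R) : 0 <= (v ^+ 2 + x ^+ 2) ^- 2.
Proof. by rewrite invr_ge0 exprn_ge0// ltW. Qed.

Let student_ge0 a u : 0 <= student a u.
Proof. by apply: prodr_ge0. Qed.

Let measurable_student1 (c : R) :
  measurable_fun setT (fun x : R => (v ^+ 2 + (x - c) ^+ 2) ^- 2).
Proof.
rewrite (_ : (fun _ => _) = (fun x : R => (v ^+ 2 + (x - c) ^+ 2) `^ (1 *- 2))).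
  apply: (@measurableT_comp _ _ _ _ _ _ (fun x : R => x `^ _)).
    exact: measurable_powR.
  apply: measurable_funD => //; apply: measurable_funX; exact: measurable_funB.
by apply/funext => x; rewrite powR_invn// ltW.
Qed.

Let measurable_student a : measurable_fun setT (student a).
Proof.
apply: measurable_prod => i _.
by apply: (measurableT_comp (measurable_student1 _)); exact: measurable_tnth.
Qed.

Let I0_gt0 : 0 < I0.
Proof. by rewrite mulr_gt0 ?divr_gt0 ?pi_gt0// invr_gt0 exprn_gt0. Qed.

Let integral_prod_student a :
  (\int[lebesgue_tuple d]_u (student a u)%:E = (I0 ^+ d)%:E)%E.
Proof.
rewrite (ge0_integral_lebesgue_prod (fun i => measurable_student1 (tnth a i)))//.
under eq_bigr do rewrite integral_student//.
by rewrite prodEFin prodr_const card_ord.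
Qed.

Let integral_prod_student_sqr a (j : 'I_d) :
  (\int[lebesgue_tuple d]_u ((tnth u j - tnth a j) ^+ 2 * student a u)%:E =
   (v ^+ 2 * I0 ^+ d)%:E)%E.
Proof.
pose h (i : 'I_d) x := if i == j then
  (x - tnth a i) ^+ 2 * (v ^+ 2 + (x - tnth a i) ^+ 2) ^- 2
  else (v ^+ 2 + (x - tnth a i) ^+ 2) ^- 2.
have mh i : measurable_fun setT (h i).
  rewrite /h; case: (i == j) => //; apply: measurable_funM => //.
  by apply: measurable_funX; exact: measurable_funB.
have h0 i x : 0 <= h i x.
  by rewrite /h; case: ifP => // _; rewrite mulr_ge0 ?sqr_ge0.
transitivity (\int[lebesgue_tuple d]_u (\prod_i h i (tnth u i))%:E)%E.
  apply: eq_integral => u _; congr (_%:E).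
  rewrite /student (bigD1 j)//= [RHS](bigD1 j)//= {1}/h eqxx mulrA.
  by congr (_ * _); apply: eq_bigr => i /negbTE ij; rewrite /h ij.
rewrite (ge0_integral_lebesgue_prod mh h0).
have hE i : (\int[lebesgue_measure]_x (h i x)%:E =
    ((if i == j then v ^+ 2 else 1) * I0)%:E)%E.
  rewrite /h; case: (i == j); last by rewrite integral_student// mul1r.
  by rewrite integral_student_sqr//; congr (_%:E); field; rewrite gt_eqF.
under eq_bigr do rewrite hE.
rewrite prodEFin big_split/= prodr_const card_ord; congr (_ * _)%:E.
by rewrite -big_mkcond/= big_pred1_eq.
Qed.

(** Here [r] is the squared radius. *)
Definition l2ball a (r : R) : set (d.-tuple R) :=
  [set u | \sum_i (tnth u i - tnth a i) ^+ 2 <= r].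

Lemma measurable_l2ball a r : measurable (l2ball a r).
Proof.
rewrite -[X in measurable X]setTI.
apply: (@measurable_fun_le _ _ _ setT _ (cst r)) => //.
apply: measurable_sum => i; apply: measurable_funX; apply: measurable_funB => //.
exact: measurable_tnth.
Qed.

(** Cauchy-Schwarz against the constant 1 turns the Euclidean radius [2 sqrt d * v] into the
    l1-distance [2 * d * v], exactly the margin left by the hypothesis on [a]. *)
Lemma l2ball_ball1 C1 a : l1norm a <= C1 - 2 * d%:R * v ->
  l2ball a (4 * d%:R * v ^+ 2) `<=` ball1 C1.
Proof.
move=> aC u; rewrite /l2ball /ball1 /= => uA.
have := cauchy_schwarz_sum (fun i => `|tnth u i - tnth a i|) (fun=> 1).
under eq_bigr do rewrite mulr1.
under [X in _ <= X * _ -> _]eq_bigr do rewrite real_normK ?num_real//.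
rewrite expr1n sumr_const card_ord => /le_trans/(_ (ler_wpM2r (ler0n _ d) uA)).
have -> : 4 * d%:R * v ^+ 2 * d%:R = (2 * d%:R * v) ^+ 2 :> R by ring.
rewrite ler_sqr ?nnegrE ?sumr_ge0//; last by rewrite !mulr_ge0// ltW.
move=> uda; rewrite -[C1](subrK (2 * d%:R * v)) (le_trans _ (lerD aC uda))//.
rewrite -big_split/=; apply: ler_sum => i _.
by rewrite -{1}(subrKC (tnth a i) (tnth u i)) ler_normD.
Qed.

Section normalization.
Variables (C1 : R) (a : d.-tuple R).
Hypothesis d0 : (0 < d)%N.
Hypothesis aC : l1norm a <= C1 - 2 * d%:R * v.

Let A := l2ball a (4 * d%:R * v ^+ 2).
Let kappa : R := \prod_(i < d) (1 + `|tnth a i| / v) ^- 4.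

Let kappa_gt0 : 0 < kappa.
Proof.
apply: prodr_gt0 => i _; rewrite invr_gt0 exprn_gt0// ltr_wpDr// divr_ge0//.
exact: ltW.
Qed.

(** Coordinatewise [v^2 + x^2 <= (1 + |c| / v)^2 (v^2 + (x - c)^2)], a consequence of
    [2 |x - c| v <= v^2 + (x - c)^2]. The exponent 2 of the density turns the square into a fourth
    power. *)
Let kappa_student u : kappa * student a u <=
  \prod_(i < d) (v ^+ 2 + tnth u i ^+ 2) ^- 2.
Proof.
rewrite -big_split/=; apply: ler_prod => i _.
set x := tnth u i; set c := tnth a i.
have c0 : 0 < 1 + `|c| / v by rewrite ltr_wpDr// divr_ge0// ltW.
have xc0 := ltW (student_gt0 (x - c)).
rewrite mulr_ge0 ?invr_ge0 ?exprn_ge0 ?(ltW c0)//=.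
rewrite -invfM lef_pV2 ?posrE ?mulr_gt0 ?exprn_gt0//.
rewrite (_ : (1 + `|c| / v) ^+ 4 = ((1 + `|c| / v) ^+ 2) ^+ 2); last by rewrite -exprM.
rewrite -exprMn ler_sqr ?nnegrE ?mulr_ge0 ?(ltW c0) ?(ltW (student_gt0 x)) ?(ltW (student_gt0 (x - c)))//.
have -> : (1 + `|c| / v) ^+ 2 * (v ^+ 2 + (x - c) ^+ 2) =
    (v ^+ 2 + (x - c) ^+ 2) + 2 * `|c| * ((v ^+ 2 + (x - c) ^+ 2) / v) +
    (`|c| ^+ 2 + `|c| ^+ 2 * ((x - c) / v) ^+ 2).
  by field; rewrite gt_eqF.
have H : 2 * `|x - c| <= (v ^+ 2 + (x - c) ^+ 2) / v.
  rewrite ler_pdivlMr// -[(x - c) ^+ 2]real_normK ?num_real//.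
  by have := sqr_ge0 (v - `|x - c|); nra.
have -> : x = (x - c) + c by ring.
set y := x - c in H *; rewrite addrK.
have K : y * c <= `|y| * `|c| by rewrite -normrM ler_norm.
have c2 : `|c| ^+ 2 = c ^+ 2 by rewrite real_normK ?num_real.
have P1 := mulr_ge0 (normr_ge0 c) (normr_ge0 y).
have P2 := ler_wpM2l (normr_ge0 c) H.
have P3 : 0 <= `|c| ^+ 2 * (y / v) ^+ 2 by rewrite mulr_ge0 ?sqr_ge0.
by rewrite c2 in P3 *; nra.
Qed.

Let dens := with_density (lebesgue_tuple d) (measurable_prior_weight C1 v)
  (prior_weight_ge0 C1 v).

Let prior_weight_int B : measurable B ->
  (dens B = \int[lebesgue_tuple d]_u (\1_B u * prior_weight C1 v u)%:E)%E.
Proof.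
move=> mB; rewrite /dens /with_density [LHS]integral_mkcond.
apply: eq_integral => u _; rewrite /patch indicE.
by case: ifPn => _; rewrite ?mul1r ?mul0r.
Qed.

(** Without the restriction to the l1-ball the weight is the centred Student product, whose integral
    equals that of its translate; this common factor cancels in the prior mass of [A]. *)
Let dens_le : (dens setT <= (I0 ^+ d)%:E)%E.
Proof.
rewrite prior_weight_int// -(integral_prod_student [tuple of nseq d 0]).
apply: ge0_le_integral => //.
- by move=> u _; rewrite lee_fin mulr_ge0 ?prior_weight_ge0// indicE.
- apply/measurable_EFinP/measurable_funM => //; exact: measurable_prior_weight.
- exact/measurable_EFinP.
- move=> u _; rewrite lee_fin indicT mul1r /prior_weight.
  rewrite (_ : student _ u = \prod_(i < d) (v ^+ 2 + tnth u i ^+ 2) ^- 2).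
    apply: ler_piMl; first exact: prodr_ge0.
    by rewrite indicE; case: (_ \in _).
  apply: eq_bigr => i _; congr ((_ + _ ^+ 2) ^- 2).
  by rewrite (tnth_nth 0) [in tnth [tuple of _] _](tnth_nth 0)/= nth_nseq ltn_ord subr0.
Qed.

Let dens_A_ge : ((3 / 4 * kappa * I0 ^+ d)%:E <= dens A)%E.
Proof.
have mA : measurable A := measurable_l2ball _ _.
have mw := @measurable_prior_weight R d C1 v.
have dv0 : 0 < 4 * d%:R * v ^+ 2 by rewrite !mulr_gt0 ?ltr0n// exprn_gt0.
pose S j u := (tnth u j - tnth a j) ^+ 2 * student a u.
have mS j : measurable_fun setT (S j).
  apply: measurable_funM => //; apply: measurable_funX.
  by apply: measurable_funB => //; exact: measurable_tnth.
have S0 j u : 0 <= S j u by rewrite mulr_ge0 ?sqr_ge0.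
(* Markov's inequality under the prior translated to [a]. *)
have key : (\int[lebesgue_tuple d]_u (kappa%:E * (student a u)%:E) <=
   \int[lebesgue_tuple d]_u ((\1_A u * prior_weight C1 v u)%:E +
     (kappa / (4 * d%:R * v ^+ 2))%:E * \sum_(j < d) (S j u)%:E))%E.
  apply: ge0_le_integral => //.
  - by move=> u _; rewrite -EFinM lee_fin mulr_ge0// ltW.
  - by apply: measurable_funeM; exact/measurable_EFinP.
  - apply: emeasurable_funD; first exact/measurable_EFinP/measurable_funM.
    apply: measurable_funeM; apply: emeasurable_sum => j.
    exact/measurable_EFinP.
  - move=> u _; rewrite sumEFin -!EFinM -EFinD lee_fin.
    rewrite -mulr_suml -/(student a u) indicE.
    have k0 := ltW kappa_gt0.
    have sum0 : 0 <= \sum_(i < d) (tnth u i - tnth a i) ^+ 2.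
      by apply: sumr_ge0 => i _; exact: sqr_ge0.
    case: (boolP (u \in A)) => [|]; rewrite ?inE ?notin_setE => uA.
      rewrite mul1r (le_trans (kappa_student u))//.
      rewrite /prior_weight indicE mem_set ?mul1r; last exact: l2ball_ball1 uA.
      by rewrite lerDl !mulr_ge0 ?invr_ge0 ?(ltW dv0).
    rewrite mul0r add0r mulrA ler_wpM2r// mulrAC ler_pdivlMr// ler_wpM2l// ltW//.
    by move/negP: uA; rewrite -ltNge.
move: key; rewrite ge0_integralZl_EFin ?(ltW kappa_gt0)//; last 2 first.
- by move=> u _; rewrite lee_fin.
- exact/measurable_EFinP.
rewrite integral_prod_student ge0_integralD//; last 4 first.
- by move=> u _; rewrite lee_fin mulr_ge0 ?prior_weight_ge0// indicE.
- exact/measurable_EFinP/measurable_funM.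
- move=> u _; rewrite mule_ge0 ?lee_fin ?divr_ge0 ?(ltW kappa_gt0) ?(ltW dv0)//.
  by apply: sume_ge0 => j _; rewrite lee_fin.
- apply: measurable_funeM; apply: emeasurable_sum => j; exact/measurable_EFinP.
rewrite -prior_weight_int// ge0_integralZl_EFin//; last 3 first.
- by move=> u _; apply: sume_ge0 => j _; rewrite lee_fin.
- apply: emeasurable_sum => j; exact/measurable_EFinP.
- by rewrite divr_ge0 ?(ltW kappa_gt0) ?(ltW dv0).
rewrite ge0_integral_sum//; last 2 first.
- by move=> j; exact/measurable_EFinP.
- by move=> j u _; rewrite lee_fin.
under eq_bigr do rewrite integral_prod_student_sqr.
rewrite sumEFin sumr_const card_ord -!EFinM => key.
(* The second moments sum to [d * v ^+ 2 * I0 ^+ d]. With squared radius [4 * d * v ^+ 2] the Markov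
   term is a quarter of [kappa * I0 ^+ d], and the factor 3/4 is what remains. *)
rewrite -(@leeD2rE _ (kappa / (4 * d%:R * v ^+ 2) * (v ^+ 2 * I0 ^+ d *+ d))%:E)//.
apply: le_trans key; rewrite -EFinD lee_fin le_eqVlt; apply/orP; left; apply/eqP.
rewrite -[_ *+ d]mulr_natr.
have dn0 : d%:R != 0 :> R by rewrite pnatr_eq0 -lt0n.
by field; rewrite dn0 gt_eqF.
Qed.

Let dens_gt0 : (0 < dens setT)%E.
Proof.
apply: (@lt_le_trans _ _ (dens A)); last first.
  by apply: le_measure; rewrite ?inE//; exact: measurable_l2ball.
apply: lt_le_trans dens_A_ge.
by rewrite lte_fin !mulr_gt0// exprn_gt0.
Qed.

Lemma prior_l2ball_ge :
  ((3 / 4 * \prod_(i < d) (1 + `|tnth a i| / v) ^- 4)%:E <= prior C1 v A)%E.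
Proof.
have foo : (dens setT < +oo)%E by rewrite (le_lt_trans dens_le)// ltry.
have ffin : dens setT \is a fin_num by rewrite ge0_fin_numE.
have f0 : 0 < fine (dens setT) by rewrite fine_gt0// dens_gt0.
(* The total weight is neither 0 nor infinite, so [mnormalize] divides by it and does not return its
   Dirac default. *)
rewrite /prior /= /mnormalize (gt_eqF dens_gt0) (lt_eqF foo)/=.
rewrite lee_pdivlMr//.
apply: le_trans dens_A_ge; rewrite -EFinM lee_fin.
rewrite ler_wpM2l ?mulr_ge0 ?(ltW kappa_gt0)// -lee_fin fineK//.
Qed.

Lemma prior_ball1C : prior C1 v (~` ball1 C1 : set (d.-tuple R)) = 0%E.
Proof.
have foo : (dens setT < +oo)%E by rewrite (le_lt_trans dens_le)// ltry.
have dB : dens (~` ball1 C1) = 0%E.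
  rewrite prior_weight_int; last by apply: measurableC; exact: measurable_ball1.
  rewrite integral0_eq// => u _; rewrite /prior_weight mulrA.
  rewrite !indicE in_setC; case: (u \in _); rewrite /= ?mulr0 ?mul0r ?mul0r//.
rewrite /prior /= /mnormalize (gt_eqF dens_gt0) (lt_eqF foo)/=.
by rewrite [X in (X * _)%E]dB mul0e.
Qed.

End normalization.
End prior_mass.

(** Only on the support do the factors differ from 1. There the arithmetic-geometric mean inequality
    trades the individual entries for the l1-norm. *)
Lemma prod_AGM_support (R : realType) d (a : d.-tuple R) (v C1 : R) :
  0 < v -> l1norm a <= C1 -> (0 < l0norm a)%N ->
  \prod_(i < d) (1 + `|tnth a i| / v) <=
  (1 + C1 / ((l0norm a)%:R * v)) ^+ (l0norm a).
Proof.
move=> v0 aC s0.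
have E0 i : 0 <= 1 + `|tnth a i| / v by rewrite addr_ge0// divr_ge0// ltW.
pose S : {pred 'I_d} := [pred i : 'I_d | tnth a i != 0].
have -> : \prod_(i < d) (1 + `|tnth a i| / v) = \prod_(i in S) (1 + `|tnth a i| / v).
  rewrite [RHS]big_mkcond/=; apply: eq_bigr => i _; rewrite inE.
  by case: eqVneq => // ->; rewrite normr0 mul0r addr0.
have [le _] := @leif_AGM R _ S (fun i => 1 + `|tnth a i| / v) (fun i _ => E0 i).
apply: (le_trans le); rewrite -/(l0norm a).
have sR : 0 < (l0norm a)%:R :> R by rewrite ltr0n.
rewrite lerXn2r ?nnegrE ?divr_ge0 ?sumr_ge0//.
  by rewrite addr_ge0 ?divr_ge0 ?mulr_ge0 ?(ltW v0)// (le_trans _ aC) ?sumr_ge0.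
rewrite ler_pdivrMr// mulrDl mul1r big_split/= sumr_const -/(l0norm a).
rewrite lerD2l -mulr_suml.
have -> : C1 / ((l0norm a)%:R * v) * (l0norm a)%:R = C1 / v.
  by field; rewrite !gt_eqF.
rewrite ler_pM2r ?invr_gt0// (le_trans _ aC)// /l1norm [leRHS](bigID (mem S))/=.
by rewrite lerDl sumr_ge0.
Qed.

(** * The PAC-Bayes inequality *)

Lemma probability_integral_gt0 d (T : measurableType d) (R : realType)
    (P : probability T R) (f : T -> R) :
  measurable_fun setT f -> (forall x, 0 < f x) ->
  (0 < \int[P]_x (f x)%:E)%E.
Proof.
move=> mf fpos; have mfE : measurable_fun setT (EFin \o f) by exact/measurable_EFinP.
rewrite lt0e; apply/andP; split; last first.
  by apply: integral_ge0 => x _; rewrite lee_fin ltW.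
apply/eqP => I0.
have := (ae_eq_integral_abs P measurableT (f := EFin \o f) mfE).1.
move=> /(_ _)[|B [mB B0 sub]].
  by rewrite -I0; apply: eq_integral => x _; rewrite gee0_abs// lee_fin ltW.
have : P B = 1%E.
  rewrite -(probability_setT P); congr (P _); apply/seteqP; split => // x _.
  apply: sub => /=; apply/not_implyP; split => //; apply/eqP.
  by rewrite eqe gt_eqF.
by rewrite B0 => /eqP; rewrite eqe eq_sym oner_eq0.
Qed.

(** * From an exponential moment to a mean and a tail bound *)

Section exponential_moment.
Context d (Omega : measurableType d) (R : realType) (Pr : probability Omega R).
Variables (X : Omega -> R) (k : R).
Hypotheses (mX : measurable_fun setT X) (X0 : forall w, 0 <= X w) (k0 : 0 <= k).
Hypothesis expX : (\int[Pr]_w (expR (X w))%:E <= (expR k)%:E)%E.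

Let mexpX : measurable_fun setT (fun w => (expR (X w))%:E).
Proof. by apply/measurable_EFinP; exact: measurableT_comp. Qed.

Lemma expectation_le_exponential_moment : (\int[Pr]_w (X w)%:E <= k%:E)%E.
Proof.
(* The tangent inequality [exp (X - k) >= 1 + X - k] is to be integrated; adding 1 and moving [k]
   across leaves only non-negative terms. *)
suff : (\int[Pr]_w (X w)%:E + 1 <= k%:E + 1)%E by rewrite leeD2rE.
rewrite -[X in (_ + X <= _)%E](probability_setT Pr) -[Pr _]mul1e -integral_cst//.
rewrite -ge0_integralD//; last 2 first.
- by move=> w _; rewrite lee_fin.
- exact/measurable_EFinP.
have le1 w : X w + 1 <= expR (- k) * expR (X w) + k.
  by rewrite -expRD; have := expR_ge1Dx (- k + X w); lra.
apply: (@le_trans _ _ (\int[Pr]_w ((expR (- k))%:E * (expR (X w))%:E + k%:E))%E).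
  apply: ge0_le_integral => //.
  - by move=> w _; rewrite lee_fin addr_ge0.
  - by apply: emeasurable_funD => //; exact/measurable_EFinP.
  - by apply: emeasurable_funD => //; exact: measurable_funeM.
  - by move=> w _; rewrite -EFinM -!EFinD lee_fin.
rewrite ge0_integralD//; last by exact: measurable_funeM.
rewrite ge0_integralZl_EFin ?expR_ge0//.
rewrite integral_cst//= probability_setT mule1 addeC leeD2l//.
apply: (le_trans (lee_wpmul2l _ expX)); first by rewrite lee_fin expR_ge0.
by rewrite -EFinM -expRD addNr expR0.
Qed.

(** Markov's inequality for [exp X] at the level [exp k / eps], applied to the complementary
    event. *)
Lemma exponential_moment_tail (eps : R) : 0 < eps ->
  ((1 - eps)%:E <= Pr [set w | (X w <= k + ln eps^-1)%R])%E.
Proof.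
move=> eps0.
have mS : measurable [set w | (X w <= k + ln eps^-1)%R].
  by rewrite -[X in measurable X]setTI; exact: measurable_fun_le.
have mSc := measurableC mS.
have -> : [set w | (X w <= k + ln eps^-1)%R] = ~` ~` [set w | (X w <= k + ln eps^-1)%R].
  by rewrite setCK.
rewrite probability_setC// EFinB leeD2l// leeN2.
set S := ~` _ in mSc *.
have : ((expR k / eps)%:E * Pr S <= (expR k)%:E)%E.
  apply: le_trans expX.
  rewrite -[X in Pr X]setIT -integral_indic// -ge0_integralZl_EFin//; last 2 first.
  - by apply/measurable_EFinP.
  - by rewrite divr_ge0 ?expR_ge0// ltW.
  apply: ge0_le_integral => //.
  - by move=> w _; rewrite -EFinM lee_fin mulr_ge0// divr_ge0 ?expR_ge0// ltW.
  - by apply: measurable_funeM; apply/measurable_EFinP.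
  - move=> w _; rewrite -EFinM lee_fin indicE.
    case: (boolP (w \in S)) => [|_]; last by rewrite mulr0 expR_ge0.
    rewrite inE /S /= => /negP; rewrite -ltNge => lt.
    rewrite mulr1 -[eps^-1]lnK ?posrE ?invr_gt0// -expRD ler_expR.
    exact: ltW.
rewrite -[X in (_ <= X)%E]mule1.
have -> : (expR k / eps)%:E = ((expR k)%:E * (eps^-1)%:E)%E by rewrite EFinM.
rewrite -muleA lee_pmul2l ?lte_fin ?expR_gt0//.
have : (0 < eps^-1)%R by rewrite invr_gt0.
move=> e0; rewrite muleC -lee_pdivlMr// mul1e.
by rewrite invrK.
Qed.

End exponential_moment.

(** * Exponential moment of a posterior mean *)

Section pac_bayes.
Context d d' (Omega : measurableType d) (T : measurableType d') (R : realType).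
Variables (Pr : probability Omega R) (pi : probability T R).
Variables (L : Omega * T -> R) (h : T -> R) (A : set T) (a b p H : R).
Hypotheses (mL : measurable_fun setT L) (mh : measurable_fun setT h).
Hypotheses (h0 : forall t, 0 <= h t) (hH : forall t, h t <= H).
Hypothesis Lge : forall w, exists c, forall t, c <= L (w, t).
Hypothesis a0 : 0 <= a.
Hypothesis mA : measurable A.
Hypotheses (p0 : 0 < p) (pA : pi A = p%:E).
Hypothesis expNL : {ae pi, forall t,
  (\int[Pr]_w (expR (- L (w, t)))%:E <= (expR (- a * h t))%:E)%E}.
Hypothesis expL : forall t, A t ->
  (\int[Pr]_w (expR (L (w, t)))%:E <= (expR b)%:E)%E.

Local Open Scope ereal_scope.

Let Z w := \int[pi]_t (expR (- L (w, t)))%:E.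
Let N w := \int[pi]_t (h t * expR (- L (w, t)))%:E.

(** Written as a quotient of prior integrals, so that measurability in [w] follows from Tonelli's
    theorem; [integral_gibbs] relates such a quotient to an integral under the normalized
    posterior. *)
Definition posterior_mean (w : Omega) : R := (fine (N w) / fine (Z w))%R.

Let mLw w : measurable_fun setT (fun t => L (w, t)).
Proof. exact: measurableT_comp. Qed.

Let meNL w : measurable_fun setT (fun t => expR (- L (w, t))).
Proof. by apply: measurableT_comp => //; exact: measurableT_comp. Qed.

Let mheNL w : measurable_fun setT (fun t => h t * expR (- L (w, t)))%R.
Proof. exact: measurable_funM. Qed.

Let Z0 w : 0 < Z w.
Proof.
apply: probability_integral_gt0 => // t; exact: expR_gt0.
Qed.

Let Zfin w : Z w \is a fin_num.
Proof.
rewrite ge0_fin_numE ?(ltW (Z0 w))//; have [c cL] := Lge w.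
apply: (@le_lt_trans _ _ (\int[pi]_t (cst (expR (- c))%:E t))).
  apply: ge0_le_integral => //.
  - exact/measurable_EFinP.
  - by move=> t _; rewrite lee_fin ler_expR lerN2.
by rewrite integral_cst//= probability_setT mule1 ltry.
Qed.

Let fZ0 w : (0 < fine (Z w))%R.
Proof. by rewrite fine_gt0// Z0/= -ge0_fin_numE// ltW. Qed.

Let N0 w : 0 <= N w.
Proof. by apply: integral_ge0 => t _; rewrite lee_fin mulr_ge0 ?expR_ge0. Qed.

Let Nfin w : N w \is a fin_num.
Proof.
rewrite ge0_fin_numE//.
have H0 : (0 <= H)%R by exact: le_trans (h0 point) (hH point).
apply: (@le_lt_trans _ _ (\int[pi]_t (H%:E * (expR (- L (w, t)))%:E))).
  apply: ge0_le_integral => //.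
  - by move=> t _; rewrite lee_fin mulr_ge0 ?expR_ge0.
  - exact/measurable_EFinP.
  - by apply: measurable_funeM; exact/measurable_EFinP.
  - by move=> t _; rewrite -EFinM lee_fin ler_wpM2r ?expR_ge0.
rewrite ge0_integralZl_EFin//.
- by rewrite -/(Z w) -(fineK (Zfin w)) -EFinM ltry.
- exact/measurable_EFinP.
Qed.

Lemma posterior_mean_ge0 w : (0 <= posterior_mean w)%R.
Proof. by rewrite divr_ge0 ?fine_ge0// ltW. Qed.

Let mZ : measurable_fun setT Z.
Proof.
apply: (@measurable_fun_fubini_tonelli_F _ _ _ _ _ pi
  (fun x => (expR (- L x))%:E)); last by move=> x; rewrite lee_fin expR_ge0.
by apply/measurable_EFinP; do 2 apply: measurableT_comp => //.
Qed.

Let mN : measurable_fun setT N.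
Proof.
apply: (@measurable_fun_fubini_tonelli_F _ _ _ _ _ pi
  (fun x => (h x.2 * expR (- L x))%:E)); last first.
  by move=> x; rewrite lee_fin mulr_ge0 ?expR_ge0.
apply/measurable_EFinP/measurable_funM; first exact: measurableT_comp.
by do 2 apply: measurableT_comp => //.
Qed.

Lemma measurable_posterior_mean : measurable_fun setT posterior_mean.
Proof.
rewrite (_ : posterior_mean =
    (fun w => fine (N w) * (fine (Z w)) `^ (-1))%R); last first.
  by apply/funext => w; rewrite powR_inv1// ltW.
apply: measurable_funM; first exact: measurableT_comp.
apply: (@measurableT_comp _ _ _ _ _ _ (fun x : R => (x `^ (-1))%R)).
  exact: measurable_powR.
exact: measurableT_comp.
Qed.

(* The tangent of [exp] at [a * posterior_mean w] plays the role of the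
   Donsker-Varadhan inequality. *)
Let exp_posterior_mean_le w :
  (expR (a * posterior_mean w))%:E * Z w <=
  \int[pi]_t (expR (a * h t - L (w, t)))%:E.
Proof.
set g := posterior_mean w.
have g0 : (0 <= g)%R := posterior_mean_ge0 w.
set e := expR (a * g).
have e0 : (0 <= e)%R by exact: expR_ge0.
(* Since [g] is the posterior mean, the first-order term of the tangent at [a * g] integrates to
   zero against the posterior weight; here the denominator is cleared. *)
have agN : (e * a)%:E * N w = (e * (a * g))%:E * Z w.
  rewrite -(fineK (Nfin w)) -(fineK (Zfin w)) -!EFinM /g /posterior_mean.
  by congr (_%:E); field; rewrite gt_eqF.
have key : \int[pi]_t (e * expR (- L (w, t)) + e * a * (h t * expR (- L (w, t))))%:E
    <= \int[pi]_t (expR (a * h t - L (w, t)) + e * (a * g) * expR (- L (w, t)))%:E.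
  apply: ge0_le_integral => //.
  - move=> t _; rewrite lee_fin addr_ge0 ?mulr_ge0 ?expR_ge0//.
  - apply/measurable_EFinP/measurable_funD; exact: measurable_funM.
  - apply/measurable_EFinP/measurable_funD; last exact: measurable_funM.
    by apply: measurableT_comp => //; apply: measurable_funB => //; exact: measurable_funM.
  - move=> t _; rewrite lee_fin expRD mulrA -!mulrDl ler_wpM2r ?expR_ge0//.
    have := expR_ge1Dx (a * h t - a * g).
    have -> : expR (a * h t) = (e * expR (a * h t - a * g))%R.
      by rewrite /e -expRD; congr expR; ring.
    by move=> /(ler_wpM2l e0); lra.
move: key.
under eq_integral do rewrite EFinD.
rewrite ge0_integralD//; last 4 first.
- by move=> t _; rewrite lee_fin mulr_ge0// expR_ge0.
- by apply/measurable_EFinP/measurable_funM.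
- by move=> t _; rewrite lee_fin !mulr_ge0// expR_ge0.
- by apply/measurable_EFinP/measurable_funM.
under [X in _ <= X -> _]eq_integral do rewrite EFinD.
rewrite ge0_integralD//; last 3 first.
- apply/measurable_EFinP; apply: measurableT_comp => //.
  by apply: measurable_funB => //; exact: measurable_funM.
- by move=> t _; rewrite lee_fin; exact: mulr_ge0 (mulr_ge0 e0 (mulr_ge0 a0 g0)) (expR_ge0 _).
- by apply/measurable_EFinP/measurable_funM.
under eq_integral do rewrite EFinM.
rewrite ge0_integralZl_EFin//; last first.
  exact/measurable_EFinP.
under [X in _ + X <= _]eq_integral do rewrite EFinM.
rewrite ge0_integralZl_EFin ?mulr_ge0//; last 2 first.
- by move=> t _; rewrite lee_fin mulr_ge0 ?expR_ge0.
- exact/measurable_EFinP.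
under [X in _ <= _ + X -> _]eq_integral do rewrite EFinM.
have eag0 : (0 <= e * (a * g))%R by exact: mulr_ge0 e0 (mulr_ge0 a0 g0).
rewrite ge0_integralZl_EFin//; last first.
  exact/measurable_EFinP.
rewrite -/(Z w) -/(N w) agN leeD2rE//.
by rewrite -(fineK (Zfin w)) -EFinM.
Qed.

Let integral_A : \int[pi]_t (\1_A t)%:E = p%:E.
Proof. by rewrite integral_indic// setIT; exact: pA. Qed.

(** This is Cauchy-Schwarz, [p^2 <= Z] times the integral of [exp L] over [A], in linear form:
    [2 c <= x + c^2 / x] with [x = exp L] is integrated, and [c = p / Z] maximizes the resulting
    lower bound [2 c p - c^2 Z]. *)
Let inv_evidence_le w :
  (p ^+ 2 * (fine (Z w))^-1)%:E <= \int[pi]_t (\1_A t * expR (L (w, t)))%:E.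
Proof.
set z := fine (Z w); have z0 : (0 < z)%R := fZ0 w.
pose c := (p / z)%R; have c0 : (0 <= c)%R by rewrite divr_ge0// ltW.
have key : \int[pi]_t ((2 * c)%:E * (\1_A t)%:E) <=
    \int[pi]_t (\1_A t * expR (L (w, t)) + c ^+ 2 * expR (- L (w, t)))%:E.
  apply: ge0_le_integral => //.
  - move=> t _; rewrite -EFinM lee_fin; apply: mulr_ge0; first exact: mulr_ge0.
    by rewrite indicE.
  - by apply: measurable_funeM; exact/measurable_EFinP.
  - apply/measurable_EFinP/measurable_funD; apply: measurable_funM => //.
    exact: measurableT_comp.
  - move=> t _; rewrite -EFinM lee_fin.
    set x := expR (L (w, t)); have x0 : (0 < x)%R by exact: expR_gt0.
    rewrite expRN -/x indicE; case: (t \in A); last first.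
      by rewrite mulr0 mul0r add0r mulr_ge0 ?invr_ge0 ?exprn_ge0// ltW.
    rewrite mulr1 mul1r -subr_ge0.
    have -> : (x + c ^+ 2 / x - 2 * c = (x - c) ^+ 2 / x)%R.
      by field; rewrite gt_eqF.
    by rewrite divr_ge0 ?sqr_ge0// ltW.
have ind0 t : (0 <= \1_A t :> R)%R by rewrite indicE.
have c20 : (0 <= 2 * c)%R by exact: mulr_ge0.
move: key; rewrite ge0_integralZl_EFin//; last first.
  exact/measurable_EFinP.
rewrite integral_A -EFinM.
under [X in _ <= X -> _]eq_integral do rewrite EFinD.
rewrite ge0_integralD//; last 3 first.
- apply/measurable_EFinP/measurable_funM => //.
  exact: measurableT_comp.
- by move=> t _; rewrite lee_fin; exact: mulr_ge0 (sqr_ge0 _) (expR_ge0 _).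
- by apply/measurable_EFinP; exact: measurable_funM.
under [X in _ <= _ + X -> _]eq_integral do rewrite EFinM.
rewrite ge0_integralZl_EFin ?exprn_ge0//; last first.
  exact/measurable_EFinP.
rewrite -/(Z w) -(fineK (Zfin w)) -/z -EFinM.
have -> : (c ^+ 2 * z = p ^+ 2 / z)%R by rewrite /c; field; rewrite gt_eqF.
have -> : (2 * c * p = p ^+ 2 / z + p ^+ 2 / z)%R by rewrite /c; field; rewrite gt_eqF.
by rewrite EFinD leeD2rE.
Qed.

Let mW : measurable_fun setT (fun x : Omega * T => (expR (a * h x.2 - L x))%:E).
Proof.
apply/measurable_EFinP; apply: measurableT_comp => //; apply: measurable_funB => //.
by apply: measurable_funM => //; exact: measurableT_comp.
Qed.

Let mV : measurable_fun setT (fun x : Omega * T => (\1_A x.2 * expR (L x))%:E).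
Proof.
apply/measurable_EFinP/measurable_funM; last exact: measurableT_comp.
exact: measurableT_comp.
Qed.

Let V0 (x : Omega * T) : 0 <= (\1_A x.2 * expR (L x))%:E.
Proof. by rewrite lee_fin mulr_ge0 ?expR_ge0. Qed.

(* With [W = exp (a g) Z] and [V = 1 / Z], where [g] is the posterior mean, both
   [E W <= 1] and [E V <= exp b / p] hold, and [exp (a g / 2)] is the geometric
   mean of [W] and [V]. *)
Lemma pac_bayes_exponential_moment :
  \int[Pr]_w (expR (a / 2 * posterior_mean w))%:E <= (expR ((b - ln p) / 2))%:E.
Proof.
(* The square root of [expR b / p]: with this weight the two terms of the pointwise bound below have
   the same integrated bound, namely [c]. *)
set c := expR ((b - ln p) / 2); have c0 : (0 < c)%R by exact: expR_gt0.
have cc : (c ^+ 2 = expR b / p)%R.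
  by rewrite -expRM_natr -[in RHS](lnK p0) -expRN -expRD; congr expR; field.
pose W w := \int[pi]_t (expR (a * h t - L (w, t)))%:E.
(* By [inv_evidence_le] this [V] dominates [p^2 / Z], so [V / p^2] is what stands in for [1 / Z]
   below. *)
pose V w := \int[pi]_t (\1_A t * expR (L (w, t)))%:E.
have W0 w : 0 <= W w by apply: integral_ge0.
have V0' w : 0 <= V w by apply: integral_ge0 => t _; exact: V0 (w, t).
have mWw : measurable_fun setT W.
  by apply: (@measurable_fun_fubini_tonelli_F _ _ _ _ _ pi _ mW).
have mVw : measurable_fun setT V by exact: (@measurable_fun_fubini_tonelli_F _ _ _ _ _ pi _ mV).
have IW : \int[Pr]_w W w <= 1.
  (* For fixed [t] the sample expectation of [exp (- L)] is compensated by [exp (a * h t)]; this is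
     known for almost every [t] only. *)
  rewrite /W (@fubini_tonelli _ _ _ _ _ Pr pi _ mW)//.
  apply: (@le_trans _ _ (\int[pi]_t (cst 1 t))); last first.
    by rewrite integral_cst//= probability_setT mule1.
  apply: ae_ge0_le_integral => //.
  - by move=> t _; apply: integral_ge0.
  - exact: (@measurable_fun_fubini_tonelli_G _ _ _ _ _ Pr _ mW).
  - move: expNL; apply: filterS => t Ht _ /=.
    under eq_integral do rewrite expRD EFinM.
    rewrite ge0_integralZl_EFin ?expR_ge0//; last first.
      apply/measurable_EFinP; apply: measurableT_comp => //.
      by apply: measurableT_comp => //; exact: measurableT_comp.
    apply: (le_trans (lee_wpmul2l _ Ht)); first by rewrite lee_fin expR_ge0.
    by rewrite -EFinM -expRD mulNr subrr expR0.
have IV : \int[Pr]_w V w <= (expR b * p)%:E.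
  rewrite /V (@fubini_tonelli _ _ _ _ _ Pr pi _ mV)//=.
  apply: (@le_trans _ _ (\int[pi]_t ((expR b)%:E * (\1_A t)%:E))); last first.
    rewrite ge0_integralZl_EFin ?expR_ge0//; last first.
      exact/measurable_EFinP.
    by rewrite integral_A -EFinM.
  apply: ge0_le_integral => //.
  - by move=> t _; apply: integral_ge0 => w _; exact: V0 (w, t).
  - exact: (@measurable_fun_fubini_tonelli_G _ _ _ _ _ Pr _ mV).
  - by apply: measurable_funeM; exact/measurable_EFinP.
  - move=> t _; rewrite indicE; case: (boolP (t \in A)) => [/[!inE] At|_].
      by rewrite mule1; under eq_integral do rewrite mul1r; exact: expL.
    by under eq_integral do rewrite mul0r; rewrite integral0 mule0.
have point w : (2 * expR (a / 2 * posterior_mean w))%:E <=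
    c%:E * W w + (c^-1 / p ^+ 2)%:E * V w.
  set x := expR _; set z := fine (Z w); have z0 : (0 < z)%R := fZ0 w.
  have x2 : (x ^+ 2 * z)%:E <= W w.
    apply: le_trans (exp_posterior_mean_le w).
    rewrite -(fineK (Zfin w)) -EFinM lee_fin ler_wpM2r ?(ltW z0)//.
    by rewrite -expRM_natr ler_expR; lra.
  apply: (@le_trans _ _ (c%:E * (x ^+ 2 * z)%:E +
      (c^-1 / p ^+ 2)%:E * (p ^+ 2 * z^-1)%:E)); last first.
    apply: leeD; apply: lee_wpmul2l => //; first by rewrite lee_fin ltW.
      by rewrite lee_fin divr_ge0 ?invr_ge0 ?exprn_ge0// ltW.
    exact: inv_evidence_le.
  rewrite -!EFinM -EFinD lee_fin -subr_ge0.
  have -> : (c * (x ^+ 2 * z) + c^-1 / p ^+ 2 * (p ^+ 2 / z) - 2 * x =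
      (x * (c * z) - 1) ^+ 2 / (c * z))%R.
    by field; rewrite !gt_eqF.
  by rewrite divr_ge0 ?sqr_ge0// mulr_ge0 ?ltW.
have mg : measurable_fun setT (fun w => expR (a / 2 * posterior_mean w)).
  apply: measurableT_comp => //; apply: measurable_funM => //.
  exact: measurable_posterior_mean.
rewrite -(@lee_pmul2l _ 2%:E)// -ge0_integralZl_EFin//; last exact/measurable_EFinP.
apply: (@le_trans _ _ (\int[Pr]_w (c%:E * W w + (c^-1 / p ^+ 2)%:E * V w))).
  apply: ge0_le_integral => //.
  - by apply: measurable_funeM; exact/measurable_EFinP.
  - by apply: emeasurable_funD; exact: measurable_funeM.
  - by move=> w _; rewrite -EFinM; exact: point.
have cp0 : (0 <= c^-1 / p ^+ 2)%R by rewrite divr_ge0 ?invr_ge0 ?exprn_ge0// ltW.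
rewrite ge0_integralD//; last 4 first.
- by move=> w _; rewrite mule_ge0// lee_fin ltW.
- exact: measurable_funeM.
- by move=> w _; rewrite mule_ge0// lee_fin ltW.
- exact: measurable_funeM.
rewrite !ge0_integralZl_EFin ?(ltW c0)//.
apply: (@le_trans _ _ (c%:E * 1 + (c^-1 / p ^+ 2)%:E * (expR b * p)%:E)).
  by apply: leeD; apply: lee_wpmul2l => //; rewrite lee_fin ltW.
rewrite mule1 -!EFinM -EFinD lee_fin.
have -> : (expR b = c ^+ 2 * p)%R by rewrite cc mulfVK// gt_eqF.
rewrite le_eqVlt; apply/orP; left; apply/eqP; field.
by rewrite !gt_eqF.
Qed.

End pac_bayes.

(** * Exponential moments under a Bernstein condition and for i.i.d. samples *)

Section bernstein.
Context d (T : measurableType d) (R : realType) (P : probability T R).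
Variables (a b q : T -> R) (t ra rb Q : R).
Hypotheses (ma : measurable_fun setT a) (mb : measurable_fun setT b)
  (mq : measurable_fun setT q).
Hypotheses (a0 : forall z, 0 <= a z) (b0 : forall z, 0 <= b z)
  (q0 : forall z, 0 <= q z) (t0 : 0 <= t).
Hypothesis tab : {ae P, forall z, `|t * (b z - a z)| <= 1}.
Hypothesis abq : forall z, (b z - a z) ^+ 2 <= q z.
Hypotheses (ia : (\int[P]_z (a z)%:E = ra%:E)%E) (ib : (\int[P]_z (b z)%:E = rb%:E)%E)
  (iq : (\int[P]_z (q z)%:E <= Q%:E)%E).
Local Open Scope ereal_scope.

Lemma expectation_expR_le :
  \int[P]_z (expR (t * (b z - a z)))%:E <=
  (expR (t * (rb - ra) + 3 / 2 * t ^+ 2 * Q))%:E.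
Proof.
have k0 : (0 <= 3 / 2 * t ^+ 2)%R by rewrite mulr_ge0// exprn_ge0.
have me : measurable_fun setT (fun z => expR (t * (b z - a z))).
  by apply: measurableT_comp => //; apply: measurable_funM => //; exact: measurable_funB.
have mta : measurable_fun setT (fun z => t * a z)%R by exact: measurable_funM.
have mtb : measurable_fun setT (fun z => t * b z)%R by exact: measurable_funM.
have mtq : measurable_fun setT (fun z => 3 / 2 * t ^+ 2 * q z)%R by exact: measurable_funM.
(* The quadratic bound on the exponential with [t * a z] moved to the left, so that [ra] and [rb]
   come out of two integrals of non-negative functions. *)
have key : \int[P]_z (expR (t * (b z - a z)) + t * a z)%:E <=
    \int[P]_z (1 + t * b z + 3 / 2 * t ^+ 2 * q z)%:E.
  apply: ae_ge0_le_integral => //.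
  - by move=> z _; rewrite lee_fin addr_ge0 ?expR_ge0 ?mulr_ge0.
  - exact/measurable_EFinP/measurable_funD.
  - by move=> z _; rewrite lee_fin !addr_ge0 ?mulr_ge0 ?exprn_ge0.
  - by apply/measurable_EFinP; do 2 apply: measurable_funD => //.
  - move: tab; apply: filterS => z tz _ /=; rewrite lee_fin.
    have := expR_le_quadratic tz.
    have := ler_wpM2l k0 (abq z); rewrite exprMn; lra.
move: key; under eq_integral do rewrite EFinD.
rewrite ge0_integralD//; last 3 first.
- exact/measurable_EFinP.
- by move=> z _; rewrite lee_fin mulr_ge0.
- exact/measurable_EFinP.
under [X in _ + X <= _ -> _]eq_integral do rewrite EFinM.
rewrite ge0_integralZl_EFin//; last 2 first.
- by move=> z _; rewrite lee_fin.
- exact/measurable_EFinP.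
under [X in _ <= X -> _]eq_integral do rewrite EFinD.
rewrite ge0_integralD//; last 4 first.
- by move=> z _; rewrite lee_fin addr_ge0// mulr_ge0.
- by apply/measurable_EFinP; exact: measurable_funD.
- by move=> z _; rewrite lee_fin !mulr_ge0.
- exact/measurable_EFinP.
under [X in _ <= X + _ -> _]eq_integral do rewrite EFinD.
rewrite ge0_integralD//; last 2 first.
- by move=> z _; rewrite lee_fin mulr_ge0.
- exact/measurable_EFinP.
under [X in _ <= _ + X + _ -> _]eq_integral do rewrite EFinM.
rewrite ge0_integralZl_EFin//; last 2 first.
- by move=> z _; rewrite lee_fin.
- exact/measurable_EFinP.
under [X in _ <= _ + X -> _]eq_integral do rewrite EFinM.
rewrite ge0_integralZl_EFin//; last 2 first.
- by move=> z _; rewrite lee_fin.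
- exact/measurable_EFinP.
rewrite ia ib integral_cst//= probability_setT mule1 => key.
have := le_trans key (leeD2l _ (lee_wpmul2l (x := (3 / 2 * t ^+ 2)%:E) k0 iq)).
rewrite -!EFinM -!EFinD -leeBrDr// -EFinB => /le_trans; apply.
rewrite lee_fin (le_trans _ (expR_ge1Dx _))//; lra.
Qed.

End bernstein.

Section iid_product.
Context d d' (Omega : measurableType d) (T : measurableType d') (R : realType).
Variables (Pr : probability Omega R) (n : nat) (Z : 'I_n -> {RV Pr >-> T}).
Variable P : probability T R.
Local Open Scope ereal_scope.

Lemma iid_expectation_prod_le (f : T -> R) (m : R) : iid_sample Z P ->
  measurable_fun setT f -> (forall z, (0 <= f z)%R) ->
  \int[P]_z (f z)%:E <= m%:E ->
  \int[Pr]_w (\prod_i f (Z i w))%:E <= (m ^+ n)%:E.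
Proof.
move=> [ident indep] mf f0 fm.
have fZ i : \int[Pr]_w (f (Z i w))%:E = \int[P]_z (f z)%:E.
  transitivity (\int[distribution Pr (Z i)]_z (f z)%:E).
    rewrite ge0_integral_pushforward//; first exact/measurable_EFinP.
    by move=> z _; rewrite lee_fin.
  by apply: eq_measure_integral => A mA _; exact: ident.
rewrite (@ge0_expectation_prod _ _ _ _ _ _ _ _ (fun=> f))//; last first.
  by move=> i; rewrite fZ (le_lt_trans fm)// ltry.
under eq_bigr do rewrite fZ.
have I0 : 0 <= \int[P]_z (f z)%:E by apply: integral_ge0 => z _; rewrite lee_fin.
have Ifin : \int[P]_z (f z)%:E \is a fin_num.
  by rewrite ge0_fin_numE// (le_lt_trans fm)// ltry.
rewrite -(fineK Ifin) prodEFin prodr_const card_ord lee_fin.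
by apply: lerXn2r; rewrite ?nnegrE -?lee_fin ?fineK// (le_trans I0).
Qed.

End iid_product.

(** * Integrals under the Gibbs measure *)

Section gibbs_integral.
Context d (T : measurableType d) (R : realType) (pi : probability T R).
Variables (f h : T -> R) (X : T -> \bar R) (r H : R).
Hypotheses (mf : measurable_fun setT f) (mh : measurable_fun setT h)
  (mX : measurable_fun setT X).
Hypotheses (f0 : forall x, 0 <= f x) (fpos : forall x, 0 < f x) (f1 : forall x, f x <= 1).
Hypotheses (h0 : forall x, 0 <= h x) (hH : forall x, h x <= H) (r0 : 0 <= r).
Hypotheses (X0 : forall x, (0 <= X x)%E).
Hypothesis XE : {ae pi, forall x, X x = (r + h x)%:E}.
Local Open Scope ereal_scope.

(** Meant for [X] the extended-real risk and [h] the cut-off excess risk, which agree up to [r] on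
    the l1-ball, hence almost everywhere only. The bounds [0 < f <= 1] keep the normalizer in (0,
    1], away from the default of [mnormalize]. *)
Lemma integral_gibbs :
  \int[mnormalize (with_density pi mf f0) pi]_x X x =
  (r + fine (\int[pi]_x (h x * f x)%:E) / fine (\int[pi]_x (f x)%:E))%:E.
Proof.
have mfE : measurable_fun setT (EFin \o f) by exact/measurable_EFinP.
set D := \int[pi]_x (f x)%:E.
have D0 : 0 <= D by apply: integral_ge0 => x _; rewrite lee_fin.
have Dgt0 : 0 < D by exact: probability_integral_gt0.
have Dn0 : D != 0 by rewrite gt_eqF.
have D1 : D <= 1.
  apply: (@le_trans _ _ (\int[pi]_x cst 1 x)).
    apply: ge0_le_integral => //; first by move=> x _; rewrite lee_fin.
    by move=> x _; rewrite lee_fin.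
  by rewrite integral_cst//= probability_setT mule1.
have Dfin : D \is a fin_num by rewrite ge0_fin_numE// (le_lt_trans D1)// ltry.
have fD0 : (0 < fine D)%R by rewrite fine_gt0// Dgt0 -ge0_fin_numE.
have Doo : D != +oo by rewrite (lt_eqF (le_lt_trans D1 (ltry _))).
rewrite ge0_integral_mnormalize// ge0_integral_with_density//.
rewrite [X in (fine X)^-1%R](_ : _ = D)//.
have mhf : measurable_fun setT (fun x => h x * f x)%R by exact: measurable_funM.
have N0 : 0 <= \int[pi]_x (h x * f x)%:E.
  by apply: integral_ge0 => x _; rewrite lee_fin mulr_ge0.
have Nfin : \int[pi]_x (h x * f x)%:E \is a fin_num.
  rewrite ge0_fin_numE//; apply: (@le_lt_trans _ _ (\int[pi]_x cst H%:E x)).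
    apply: ge0_le_integral => //.
    - by move=> x _; rewrite lee_fin mulr_ge0.
    - exact/measurable_EFinP.
    - by move=> x _; rewrite lee_fin (le_trans _ (hH x))// ler_piMr.
  by rewrite integral_cst//= probability_setT mule1 ltry.
transitivity ((fine D)^-1%:E * \int[pi]_x (r%:E * (f x)%:E + (h x * f x)%:E)).
  congr (_ * _); apply: ge0_ae_eq_integral => //.
  - exact: emeasurable_funM.
  - by apply: emeasurable_funD; [exact: measurable_funeM|exact/measurable_EFinP].
  - by move=> x _; rewrite mule_ge0// lee_fin.
  - by move=> x _; rewrite -EFinM -EFinD lee_fin addr_ge0 ?mulr_ge0.
  - move: XE; apply: filterS => x Xx _ /=.
    by rewrite Xx -!EFinM -EFinD mulrC mulrDl.
rewrite ge0_integralD//; last 4 first.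
- by move=> x _; rewrite -EFinM lee_fin mulr_ge0.
- exact: measurable_funeM.
- by move=> x _; rewrite lee_fin mulr_ge0.
- exact/measurable_EFinP.
rewrite ge0_integralZl_EFin//; last by move=> x _; rewrite lee_fin.
rewrite -/D -[X in _ * (_ * X + _)](fineK Dfin) -[X in _ * (_ + X)](fineK Nfin).
by rewrite -(EFinM r) -EFinD -EFinM; congr (_%:E); field; rewrite gt_eqF.
Qed.

End gibbs_integral.

Section measurability.
Context {R : realType} {d : nat}.

Lemma measurable_pair_loss (tau : R) :
  measurable_fun setT
    (fun x : d.-tuple R * (R * d.-tuple R) => pair_loss tau x.1 x.2).
Proof.
have m2 : measurable_fun setT (fun x : d.-tuple R * (R * d.-tuple R) => x.2.1).
  exact: measurableT_comp.
have mdot : measurable_fun setT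
    (fun x : d.-tuple R * (R * d.-tuple R) => dotp x.2.2 x.1).
  apply: measurable_sum => i; apply: measurable_funM.
    apply: (measurableT_comp (measurable_tnth i)).
    exact: measurableT_comp.
  by apply: (measurableT_comp (measurable_tnth i)).
rewrite /pair_loss /quantile_loss.
apply: measurable_funM; first exact: measurable_funB.
apply: measurable_funB => //.
rewrite (_ : (fun _ => _) =
    (fun x : d.-tuple R * (R * d.-tuple R) => if x.2.1 <= dotp x.2.2 x.1 then 1 else 0 : R)); last first.
  by apply/funext => u; case: ifP.
by apply: measurable_fun_ifT => //; exact: measurable_fun_ler.
Qed.

Lemma measurable_pair_loss1 (tau : R) (theta : d.-tuple R) :
  measurable_fun setT (pair_loss tau theta).
Proof. exact: (measurableT_comp (measurable_pair_loss tau) (measurable_pair1 theta)). Qed.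

Lemma measurable_risk (tau : R) (P : probability (R * d.-tuple R)%type R) :
  0 < tau < 1 -> measurable_fun setT (risk tau P).
Proof.
move=> tau01.
apply: (@measurable_fun_fubini_tonelli_F _ _ _ _ _ P
  (fun x => (pair_loss tau x.1 x.2)%:E)).
  by apply/measurable_EFinP; exact: measurable_pair_loss.
by move=> x; rewrite lee_fin quantile_loss_ge0.
Qed.

End measurability.

(** * The Gibbs posterior of quantile regression *)

Section vectors_extra.
Context {R : realType} {d : nat}.
Implicit Types u v : d.-tuple R.

Lemma dotp_vec_sub (x u v : d.-tuple R) :
  dotp x (vec_sub u v) = dotp x u - dotp x v.
Proof.
rewrite /dotp -sumrB; apply: eq_bigr => i _.
by rewrite tnth_mktuple mulrBr.
Qed.

Lemma ler_abs_dotp u v : `|dotp u v| <= l2norm u * l2norm v.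
Proof.
rewrite -[leLHS]ger0_norm// -sqrtr_sqr real_normK ?num_real//.
rewrite -sqrtrM ?sumr_ge0// => [|i _]; last exact: sqr_ge0.
exact/ler_wsqrtr/cauchy_schwarz_sum.
Qed.

Lemma measurable_l2norm : measurable_fun setT (@l2norm R d).
Proof.
apply: (@measurableT_comp _ _ _ _ _ _ (@Num.sqrt R)).
  by apply: continuous_measurable_fun; exact: sqrt_continuous.
by apply: measurable_sum => i; apply: measurable_funX; exact: measurable_tnth.
Qed.

End vectors_extra.

Section gibbs_bound.
Context (R : realType).
Variables (K C C1 Cx tau : R) (n d : nat) (P : probability (R * d.-tuple R)%type R).
Context (disp : measure_display) (Omega : measurableType disp).
Variables (Pr : probability Omega R).
Variables (Z : 'I_n -> {RV Pr >-> (R * d.-tuple R)%type}) (thetas : d.-tuple R).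
Hypotheses (hC : 0 < C) (hC1 : 0 < C1) (hCx : 0 < Cx).
Hypotheses (tau01 : 0 < tau < 1) (n0 : (0 < n)%N) (d0 : (0 < d)%N).
Hypothesis iid : iid_sample Z P.
Hypothesis argmin : is_argmin_risk tau P thetas.
Hypothesis EX : (\int[P]_z (l2norm z.2)%:E <= Cx%:E)%E.
Hypothesis bernstein : forall theta : d.-tuple R, ball1 C1 theta ->
  (\int[P]_z (`|dotp z.2 (vec_sub theta thetas)| ^+ 2)%:E <=
   K%:E * (risk tau P theta - risk tau P thetas))%E.
Hypothesis bounded : forall theta : d.-tuple R, ball1 C1 theta ->
  {ae P, forall z, 0 <= pair_loss tau theta z <= C}.

Local Notation M := (Num.max (2 * K) C).
Local Notation lambda := (n%:R / M).
Local Notation v := ((Cx * n%:R * Num.sqrt d%:R)^-1).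
Local Notation s := (l0norm thetas).

Hypothesis s0 : (0 < s)%N.
Hypothesis l1s : l1norm thetas <= C1 - 2 * d%:R * v.

Local Notation pi := (prior C1 v : probability (d.-tuple R) R).
Local Notation rho := (fun w : Omega =>
    gibbs_posterior tau lambda pi (fun i => Z i w)).
Local Notation r := (fine (risk tau P thetas)).

Implicit Types (theta : d.-tuple R) (z : R * d.-tuple R).

Let nR : 0 < n%:R :> R. Proof. by rewrite ltr0n. Qed.
Let sqd0 : 0 < Num.sqrt d%:R :> R. Proof. by rewrite sqrtr_gt0 ltr0n. Qed.
Let v0 : 0 < v. Proof. by rewrite invr_gt0 !mulr_gt0. Qed.
Let M0 : 0 < M. Proof. by rewrite lt_max hC orbT. Qed.
(** For [t = M^-1] this bounds the quadratic term [3/2 t^2 K h] by [3/4 t h], whence the constants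
    [1/4 = 1 - 3/4] and [7/4 = 1 + 3/4]. Its companion [tC] keeps the exponents in [-1, 1]. *)
Let tK : M^-1 * K <= 1 / 2.
Proof.
rewrite mulrC ler_pdivrMr// (@le_trans _ _ (1 / 2 * (2 * K)))//.
  by rewrite mulrA divfK ?mul1r.
by rewrite ler_wpM2l// le_max lexx.
Qed.
Let tC : M^-1 * C <= 1.
Proof. by rewrite mulrC ler_pdivrMr// mul1r le_max lexx orbT. Qed.

Let loss_ge0 theta z : 0 <= pair_loss tau theta z.
Proof. exact: quantile_loss_ge0. Qed.

Let mloss theta : measurable_fun setT (pair_loss tau theta).
Proof. exact: measurable_pair_loss1. Qed.

Let ball_thetas : ball1 C1 thetas.
Proof.
rewrite /ball1/= (le_trans l1s)// lerBlDr lerDl !mulr_ge0//.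
exact: ltW.
Qed.

Let risk_ge0 theta : (0 <= risk tau P theta)%E.
Proof. by apply: integral_ge0 => z _; rewrite lee_fin. Qed.

Let risk_le theta : ball1 C1 theta -> (risk tau P theta <= C%:E)%E.
Proof.
move=> Bt; apply: (@le_trans _ _ (\int[P]_z cst C%:E z)%E); last first.
  by rewrite integral_cst//= probability_setT mule1.
apply: ae_ge0_le_integral => //.
- by move=> z _; rewrite lee_fin.
- exact/measurable_EFinP.
- by move=> z _; rewrite lee_fin ltW.
- by move: (bounded Bt); apply: filterS => z /andP[_ +] _; rewrite lee_fin.
Qed.

Let risk_fin theta : ball1 C1 theta -> risk tau P theta \is a fin_num.
Proof.
by move=> Bt; rewrite ge0_fin_numE// (le_lt_trans (risk_le Bt))// ltry.
Qed.

Lemma risk_argminE : risk tau P thetas = r%:E.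
Proof. by rewrite fineK// risk_fin. Qed.

Let rE := risk_argminE.

Let r0 : 0 <= r. Proof. exact: fine_ge0. Qed.

(** The cut-off makes the bounds 0 and [C] hold for every [theta], although the loss is controlled
    on the l1-ball only. *)
Definition excess theta := \1_(ball1 C1) theta * (fine (risk tau P theta) - r).

Let excessE theta : ball1 C1 theta -> risk tau P theta = (r + excess theta)%:E.
Proof.
move=> Bt; rewrite /excess indicE mem_set// mul1r addrC subrK fineK//.
exact: risk_fin.
Qed.

Let excess_ge0 theta : 0 <= excess theta.
Proof.
rewrite /excess indicE; case: (boolP (theta \in _)) => [|_]; last by rewrite mul0r.
rewrite inE => Bt; rewrite mul1r subr_ge0 fine_le ?risk_fin//.
Qed.

Let excess_le theta : excess theta <= C.
Proof.
rewrite /excess indicE; case: (boolP (theta \in _)) => [|_]; last by rewrite mul0r ltW.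
rewrite inE => Bt; rewrite mul1r lerBlDr (@le_trans _ _ C)//; last by rewrite lerDl.
by rewrite -lee_fin fineK ?risk_fin// risk_le.
Qed.

Let mexcess : measurable_fun setT excess.
Proof.
apply: measurable_funM; first by apply: measurable_indic; exact: measurable_ball1.
apply: measurable_funB => //.
by apply: measurableT_comp => //; exact: measurable_risk.
Qed.

Let loss_lip theta theta' z :
  `|pair_loss tau theta z - pair_loss tau theta' z| <=
  `|dotp z.2 (vec_sub theta theta')|.
Proof. by rewrite dotp_vec_sub; exact: quantile_loss_lip. Qed.

Let mdotp theta : measurable_fun setT
  (fun z : R * d.-tuple R => dotp z.2 theta).
Proof.
apply: measurable_sum => i; apply: measurable_funM => //.
by apply: (measurableT_comp (measurable_tnth i)).
Qed.

Let bounded_diff theta : ball1 C1 theta -> {ae P, forall z,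
  `|M^-1 * (pair_loss tau thetas z - pair_loss tau theta z)| <= 1}.
Proof.
move=> Bt; move: (bounded Bt) (bounded ball_thetas); apply: filterS2 => z.
move=> /andP[a0 aC] /andP[b0 bC].
rewrite normrM ger0_norm ?invr_ge0 ?(ltW M0)//.
apply: le_trans tC; rewrite ler_wpM2l ?invr_ge0 ?(ltW M0)//.
by rewrite ler_norml; apply/andP; split; lra.
Qed.

Let bernstein_excess theta : ball1 C1 theta ->
  (\int[P]_z (`|dotp z.2 (vec_sub theta thetas)| ^+ 2)%:E <=
    (K * excess theta)%:E)%E.
Proof.
move=> Bt; apply: (le_trans (bernstein Bt)).
rewrite rE excessE// -EFinB -EFinM lee_fin.
by rewrite [r + _]addrC addrK.
Qed.

Let one_exp_neg theta : ball1 C1 theta ->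
  (\int[P]_z (expR (M^-1 * (pair_loss tau thetas z - pair_loss tau theta z)))%:E
   <= (expR (- (M^-1 / 4) * excess theta))%:E)%E.
Proof.
move=> Bt.
apply: le_trans (expectation_expR_le (mloss theta) (mloss thetas)
  (q := fun z => `|dotp z.2 (vec_sub theta thetas)| ^+ 2) _ _ _ _ _ _ _
  (excessE Bt) rE (bernstein_excess Bt)) _ => //.
- by apply: measurable_funX; exact: measurableT_comp.
- by rewrite invr_ge0 ltW.
- exact: bounded_diff.
- move=> z; rewrite -[leLHS]real_normK ?num_real// ler_sqr ?nnegrE// distrC.
  exact: loss_lip.
- rewrite lee_fin ler_expR.
  have M0' : 0 < M^-1 by rewrite invr_gt0.
  have := ler_wpM2l (ltW M0') (ler_wpM2r (excess_ge0 theta) tK).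
  lra.
Qed.

Let one_exp_pos theta : ball1 C1 theta ->
  (\int[P]_z (expR (M^-1 * (pair_loss tau theta z - pair_loss tau thetas z)))%:E
   <= (expR (7 / 4 * M^-1 * excess theta))%:E)%E.
Proof.
move=> Bt.
apply: le_trans (expectation_expR_le (mloss thetas) (mloss theta)
  (q := fun z => `|dotp z.2 (vec_sub theta thetas)| ^+ 2) _ _ _ _ _ _ _
  rE (excessE Bt) (bernstein_excess Bt)) _ => //.
- by apply: measurable_funX; exact: measurableT_comp.
- by rewrite invr_ge0 ltW.
- by move: (bounded_diff Bt); apply: filterS => z; rewrite !normrM distrC.
- move=> z; rewrite -[leLHS]real_normK ?num_real// ler_sqr ?nnegrE//.
- rewrite lee_fin ler_expR.
  have M0' : 0 < M^-1 by rewrite invr_gt0.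
  have := ler_wpM2l (ltW M0') (ler_wpM2r (excess_ge0 theta) tK).
  lra.
Qed.

(** This is [lambda] times the excess empirical risk, as [lambda / n = M^-1]. Centring at [thetas]
    makes the Bernstein condition applicable to each summand and does not change the posterior. *)
Definition loss_diff (x : Omega * d.-tuple R) : R := \sum_(i < n)
  M^-1 * (pair_loss tau x.2 (Z i x.1) - pair_loss tau thetas (Z i x.1)).

Let mloss_diff : measurable_fun setT loss_diff.
Proof.
have mZ i : measurable_fun setT (fun x : Omega * d.-tuple R => Z i x.1).
  by apply: (measurableT_comp (measurable_funP (Z i))).
apply: measurable_sum => i; apply: measurable_funM => //.
apply: measurable_funB; last exact: (measurableT_comp (mloss thetas) (mZ i)).
apply: (measurableT_comp (measurable_pair_loss tau)
  (g := fun x : Omega * d.-tuple R => (x.2, Z i x.1))).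
exact: measurable_fun_pair.
Qed.

Let loss_diff_ge w : exists c, forall theta, c <= loss_diff (w, theta).
Proof.
exists (\sum_(i < n) - (M^-1 * pair_loss tau thetas (Z i w))) => theta.
apply: ler_sum => i _ /=; rewrite mulrBr lerDr mulr_ge0// invr_ge0 ltW//.
Qed.

Let exp_neg theta : ball1 C1 theta ->
  (\int[Pr]_w (expR (- loss_diff (w, theta)))%:E <=
   (expR (- (lambda / 4) * excess theta))%:E)%E.
Proof.
move=> Bt.
under eq_integral do rewrite /loss_diff -sumrN expR_sum.
under eq_integral do under eq_bigr do rewrite -mulrN opprB/=.
apply: le_trans (iid_expectation_prod_le iid _ _ (one_exp_neg Bt)) _ => //.
- apply: measurableT_comp => //; apply: measurable_funM => //.
  exact: measurable_funB.
- rewrite -expRM_natr lee_fin ler_expR le_eqVlt; apply/orP; left; apply/eqP.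
  by field; rewrite gt_eqF.
Qed.

Let exp_pos theta : ball1 C1 theta ->
  (\int[Pr]_w (expR (loss_diff (w, theta)))%:E <=
   (expR (7 / 4 * lambda * excess theta))%:E)%E.
Proof.
move=> Bt.
under eq_integral do rewrite /loss_diff expR_sum/=.
apply: le_trans (iid_expectation_prod_le iid _ _ (one_exp_pos Bt)) _ => //.
- apply: measurableT_comp => //; apply: measurable_funM => //.
  exact: measurable_funB.
- rewrite -expRM_natr lee_fin ler_expR le_eqVlt; apply/orP; left; apply/eqP.
  by field; rewrite gt_eqF.
Qed.

Local Notation A := (l2ball thetas (4 * d%:R * v ^+ 2)).

Let A_ball1 : A `<=` ball1 C1.
Proof. exact: l2ball_ball1. Qed.

(** The loss is 1-Lipschitz in the prediction, so the excess risk is at most the distance to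
    [thetas] times the mean norm of the covariates, that is [2 sqrt d * v * Cx]. The choice of [v]
    makes this [2 / n]. *)
Let excess_A theta : A theta -> excess theta <= 2 / n%:R.
Proof.
move=> At; have Bt := A_ball1 At.
set u := vec_sub theta thetas.
have u2 : l2norm u <= 2 * Num.sqrt d%:R * v.
  rewrite -[leRHS]ger0_norm ?mulr_ge0 ?(ltW v0)// -sqrtr_sqr /l2norm.
  apply: ler_wsqrtr; rewrite !exprMn sqr_sqrtr// (_ : 2 ^+ 2 = 4); last by ring.
  rewrite (eq_bigr (fun i => (tnth theta i - tnth thetas i) ^+ 2)); first exact: At.
  by move=> i _; rewrite tnth_mktuple.
have l2u : 0 <= l2norm u by exact: sqrtr_ge0.
have ml2 : measurable_fun setT (fun z : R * d.-tuple R => (l2norm z.2)%:E).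
  by apply/measurable_EFinP; exact: (measurableT_comp measurable_l2norm).
have key : (risk tau P theta <= r%:E + (l2norm u)%:E * \int[P]_z (l2norm z.2)%:E)%E.
  rewrite -rE -ge0_integralZl_EFin//; last by move=> z _; rewrite lee_fin sqrtr_ge0.
  rewrite -ge0_integralD//; last 4 first.
  - by move=> z _; rewrite lee_fin.
  - exact/measurable_EFinP.
  - by move=> z _; rewrite mule_ge0 ?lee_fin ?sqrtr_ge0.
  - exact: measurable_funeM.
  apply: ge0_le_integral => //.
  - by move=> z _; rewrite lee_fin.
  - exact/measurable_EFinP.
  - by apply: emeasurable_funD; [exact/measurable_EFinP|exact: measurable_funeM].
  - move=> z _; rewrite -EFinM -EFinD lee_fin -lerBlDl mulrC.
    apply: le_trans (ler_norm _) _; apply: le_trans (loss_lip _ _ _) _.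
    exact: ler_abs_dotp.
have := le_trans key (leeD2l _ (lee_wpmul2l (x := (l2norm u)%:E) l2u EX)).
rewrite excessE// -EFinM -EFinD lee_fin lerD2l => /le_trans; apply.
apply: (le_trans (ler_wpM2r (ltW hCx) u2)).
by rewrite le_eqVlt; apply/orP; left; apply/eqP; field; rewrite !gt_eqF.
Qed.

Definition gibbs_excess : Omega -> R := posterior_mean pi loss_diff excess.

Lemma measurable_gibbs_excess : measurable_fun setT gibbs_excess.
Proof. exact: measurable_posterior_mean. Qed.

Lemma gibbs_excess_ge0 w : 0 <= gibbs_excess w.
Proof. exact: posterior_mean_ge0. Qed.

Let ball_ae (Q : d.-tuple R -> Prop) :
  (forall theta, ball1 C1 theta -> Q theta) -> {ae pi, forall theta, Q theta}.
Proof.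
move=> BQ; exists (~` ball1 C1); split.
- by apply: measurableC; exact: measurable_ball1.
- by apply: (@prior_ball1C _ _ _ v0 _ thetas).
- by move=> theta /= nQ Bt; apply: nQ; exact: BQ.
Qed.

Lemma integral_gibbs_posterior w :
  (\int[rho w]_theta risk tau P theta)%E = (r + gibbs_excess w)%:E.
Proof.
set G := gibbs_weight tau lambda (fun i => Z i w).
have mG : measurable_fun setT G := measurable_gibbs_weight tau lambda (fun i => Z i w).
have -> := @integral_gibbs _ _ _ pi G excess (risk tau P) r C
  (measurable_gibbs_weight tau lambda (fun i => Z i w)) mexcess
  (measurable_risk P tau01) (gibbs_weight_ge0 tau lambda (fun i => Z i w))
  _ _ excess_ge0 excess_le r0 risk_ge0 (ball_ae excessE).
- congr (r + _)%:E; rewrite /gibbs_excess /posterior_mean.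
  (* The weight [G] is not centred at [thetas]. The correcting factor [c] depends on the sample but
     not on [theta], so it cancels in the quotient. *)
  set c := expR (\sum_(i < n) M^-1 * pair_loss tau thetas (Z i w)).
  have c0 : 0 < c by exact: expR_gt0.
  have GE theta : expR (- loss_diff (w, theta)) = c * G theta.
    rewrite /G /gibbs_weight /c -expRD; congr expR.
    rewrite /empirical_risk /loss_diff/= -mulr_sumr sumrB -mulr_sumr.
    by field; rewrite !gt_eqF.
  (* As [fine] is 0 at both infinities, the factor comes out without a finiteness argument. *)
  have fineZ (x : \bar R) : fine (c%:E * x) = c * fine x.
    by case: x => [x| |]; rewrite ?gt0_muley ?gt0_muleNy ?lte_fin//= ?mulr0.
  have mGe : measurable_fun setT (EFin \o G) by exact/measurable_EFinP.
  transitivity (fine (c%:E * \int[pi]_t (excess t * G t)%:E) /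
    fine (c%:E * \int[pi]_t (G t)%:E)).
    by rewrite !fineZ -mulf_div divff ?mul1r// gt_eqF.
  rewrite -!ge0_integralZl_EFin ?(ltW c0)//; last 3 first.
  + by move=> t _; rewrite lee_fin expR_ge0.
  + by move=> t _; rewrite lee_fin mulr_ge0// expR_ge0.
  + exact/measurable_EFinP/measurable_funM.
  congr (fine _ / fine _); apply: eq_integral => t _; rewrite GE//.
  by rewrite -EFinM mulrCA.
- by move=> theta; exact: expR_gt0.
- move=> theta; rewrite -expR0 ler_expR mulNr oppr_le0 !mulr_ge0 ?sumr_ge0//.
    by rewrite invr_ge0 ltW.
Qed.

Local Notation y := (n%:R * Num.sqrt d%:R / s%:R : R).

(** An upper bound for [(b - ln p) / 2] with [b = 7/2 M^-1] and [p] the prior mass of the ball: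
    [1/6] is half of [1/3 >= ln (4/3)], the cost of the factor 3/4, and the logarithm is that of
    [1 + C1 / (s * v)], with coefficient half of [4 * s]. *)
Definition gibbs_rate : R :=
  7 / 4 * M^-1 + 1 / 6 + 2 * s%:R * ln (1 + C1 * Cx * y).

Let y0 : 0 < y. Proof. by rewrite divr_gt0 ?mulr_gt0// ltr0n. Qed.

Lemma gibbs_exponential_moment :
  (\int[Pr]_w (expR (lambda / 8 * gibbs_excess w))%:E <= (expR gibbs_rate)%:E)%E.
Proof.
have mA : measurable A := measurable_l2ball _ _.
have Afin : pi A \is a fin_num by exact: fin_num_measure.
pose p := fine (pi A).
have pA : pi A = p%:E by rewrite /p fineK.
have p_ge := prior_l2ball_ge v0 d0 l1s; rewrite [X in (_ <= X)%E]pA lee_fin in p_ge.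
set B := 1 + C1 * Cx * y.
have B0 : 0 < B by rewrite addr_gt0// mulr_gt0// mulr_gt0.
have p_ge' : 3 / 4 * (B ^+ s) ^- 4 <= p.
  apply: le_trans p_ge; rewrite ler_wpM2l//.
  have E0 i : 0 < 1 + `|tnth thetas i| / v by rewrite ltr_wpDr// divr_ge0// ltW.
  have -> : \prod_(i < d) (1 + `|tnth thetas i| / v) ^- 4 =
      (\prod_(i < d) (1 + `|tnth thetas i| / v)) ^- 4.
    by rewrite prodfV -prodrXl.
  rewrite lef_pV2 ?posrE ?exprn_gt0 ?prodr_gt0//.
  rewrite lerXn2r ?nnegrE ?exprn_ge0 ?prodr_ge0 ?(ltW B0)//; first by move=> i _; exact: ltW.
  have -> : B = 1 + C1 / (s%:R * v).
    by rewrite /B; congr (1 + _); field; rewrite !gt_eqF// ltr0n.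
  exact: prod_AGM_support v0 ball_thetas s0.
have q0 : 0 < 3 / 4 * (B ^+ s) ^- 4 by rewrite mulr_gt0// invr_gt0 !exprn_gt0.
have p0 : 0 < p by exact: lt_le_trans p_ge'.
have lnp : - ln p <= 1 / 3 + 4 * s%:R * ln B.
  have : ln (3 / 4 * (B ^+ s) ^- 4) <= ln p by rewrite ler_ln ?posrE.
  rewrite lnM ?posrE ?invr_gt0 ?exprn_gt0// lnV ?posrE ?exprn_gt0//.
  rewrite !lnXn ?exprn_gt0//.
  have : ln (1 + 1 / 3) <= 1 / 3 :> R by apply: le_ln1Dx; lra.
  have -> : 1 + 1 / 3 = (3 / 4)^-1 :> R by field.
  rewrite lnV ?posrE// -[_ *+ s *+ 4]mulr_natr -[_ *+ s]mulr_natr; lra.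
have b_le theta : A theta ->
    (\int[Pr]_w (expR (loss_diff (w, theta)))%:E <= (expR (7 / 2 * M^-1))%:E)%E.
  move=> At; apply: (le_trans (exp_pos (A_ball1 At))).
  rewrite lee_fin ler_expR.
  apply: (@le_trans _ _ (7 / 4 * lambda * (2 / n%:R))).
    by rewrite ler_wpM2l ?excess_A// mulr_ge0// divr_ge0 ?(ltW M0).
  by rewrite le_eqVlt; apply/orP; left; apply/eqP; field; rewrite !gt_eqF.
have a0 : 0 <= lambda / 4 by rewrite !divr_ge0 ?(ltW M0).
have := pac_bayes_exponential_moment mloss_diff mexcess excess_ge0 excess_le
  loss_diff_ge a0 mA p0 pA (ball_ae exp_neg) b_le.
have -> : lambda / 4 / 2 = lambda / 8 by field; rewrite gt_eqF.
move=> /le_trans; apply; rewrite lee_fin ler_expR /gibbs_rate -/B; lra.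
Qed.

End gibbs_bound.

(** * Explicit constants and the two risk bounds *)

Lemma rate_le (R : realType) (C1 Cx M : R) (n d s : nat) :
  0 < C1 -> 0 < Cx -> 0 < M -> (1 <= s)%N -> (s < n)%N -> (n < d)%N ->
  8 * M / n%:R * (7 / 4 * M^-1 + 1 / 6 +
    2 * s%:R * ln (1 + C1 * Cx * (n%:R * Num.sqrt d%:R / s%:R))) <=
  (42 + M * (20 + 48 * ln (1 + C1 * Cx))) *
    (s%:R * ln (n%:R * Num.sqrt d%:R / s%:R) / n%:R).
Proof.
move=> hC1 hCx M0 s0 sn nd.
have sR : 1 <= s%:R :> R by rewrite ler1n.
have nR : 0 < n%:R :> R by rewrite ltr0n (leq_ltn_trans _ sn).
(* The chain [1 <= s < n < d] forces [d >= 3]. Hence [y] is bounded away from 1 and [ln y >= 1 / 3],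
   which lets additive constants be absorbed into [s * ln y]. *)
have sqd : 3 / 2 <= Num.sqrt d%:R :> R.
  rewrite -[leLHS]ger0_norm// -sqrtr_sqr; apply: ler_wsqrtr.
  have d3 : (3 <= d)%N by rewrite (leq_trans _ nd)// ltnS (leq_trans _ sn).
  by rewrite (@le_trans _ _ 3)// ?ler_nat//; lra.
set y := n%:R * Num.sqrt d%:R / s%:R.
have y32 : 3 / 2 <= y.
  rewrite /y mulrAC -[leLHS]mul1r; apply: ler_pM => //.
  rewrite ler_pdivlMr; last exact: lt_le_trans sR.
  by rewrite mul1r ler_nat ltnW.
clearbody y; have y0 : 0 < y by lra.
have l13 : 1 / 3 <= ln y.
  rewrite -[y]invrK lnV ?posrE ?invr_gt0// lerNr.
  have yi : y^-1 <= 2 / 3.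
    by rewrite -[leRHS]invrK lef_pV2 ?posrE ?invr_gt0// invf_div.
  have -> : y^-1 = 1 + (y^-1 - 1) by ring.
  apply: le_trans (le_ln1Dx _) _; last by lra.
  by rewrite -[ltLHS]add0r ltrD2r invr_gt0.
have c0 : 0 <= C1 * Cx by rewrite mulr_ge0 ?ltW.
have lc0 : 0 <= ln (1 + C1 * Cx) by rewrite ln_ge0// lerDl.
have lB : ln (1 + C1 * Cx * y) <= ln (1 + C1 * Cx) + ln y.
  have B1 : 0 < 1 + C1 * Cx by rewrite ltr_wpDr.
  have B2 : 0 < 1 + C1 * Cx * y by rewrite ltr_wpDr// mulr_ge0// ltW.
  rewrite -lnM ?posrE// ler_ln ?posrE ?mulr_gt0//.
  by rewrite mulrDl mul1r lerD2r; lra.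
set l := ln y in l13 lB *; set lc := ln (1 + C1 * Cx) in lc0 lB *.
have -> : 8 * M / n%:R * (7 / 4 * M^-1 + 1 / 6 +
    2 * s%:R * ln (1 + C1 * Cx * y)) =
    (14 + M * (4 / 3 + 16 * s%:R * ln (1 + C1 * Cx * y))) / n%:R.
  by field; rewrite !gt_eqF.
rewrite mulrA ler_pM2r ?invr_gt0//.
have s0' : 0 <= s%:R :> R by [].
have sl : s%:R <= 3 * (s%:R * l) by have := ler_wpM2l s0' l13; lra.
(* By [1 <= s <= 3 * (s * l)], the constant 4/3 becomes 4 and joins the 16 in front of [l], while 16
   becomes 48 in front of [lc]. In the same way 14 becomes 42 at the end. *)
have key : 4 / 3 + 16 * s%:R * ln (1 + C1 * Cx * y) <= (20 + 48 * lc) * (s%:R * l).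
  have h1 := ler_wpM2l s0' lB; have h2 := ler_wpM2r lc0 sl.
  have h3 := le_trans sR sl; lra.
have := ler_wpM2l (ltW M0) key.
have h3 := le_trans sR sl; lra.
Qed.

Theorem theorem2 (R : realType) (K C C1 Cx : R)
    (hK : 0 < K) (hC : 0 < C) (hC1 : 0 < C1) (hCx : 0 < Cx) :
  exists C2 C2' : R, [/\ 0 < C2, 0 < C2' &
  forall (tau : R) (n d : nat) (P : probability (R * d.-tuple R)%type R)
    (disp : measure_display) (Omega : measurableType disp)
    (Pr : probability Omega R)
    (Z : 'I_n -> {RV Pr >-> (R * d.-tuple R)%type})
    (thetas : d.-tuple R),
  0 < tau < 1 -> (0 < n)%N -> (0 < d)%N ->
  iid_sample Z P ->
  is_argmin_risk tau P thetas ->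
  (\int[P]_z (l2norm z.2)%:E <= Cx%:E)%E ->
  (forall theta : d.-tuple R, ball1 C1 theta ->
    (\int[P]_z (`|dotp z.2 (vec_sub theta thetas)| ^+ 2)%:E <=
     K%:E * (risk tau P theta - risk tau P thetas))%E) ->
  (forall theta : d.-tuple R, ball1 C1 theta ->
    {ae P, forall z, 0 <= pair_loss tau theta z <= C}) ->
  let lambda := n%:R / Num.max (2 * K) C in
  let vsig := (Cx * n%:R * Num.sqrt d%:R)^-1 in
  let s := l0norm thetas in
  let delta := s%:R * ln (n%:R * Num.sqrt d%:R / s%:R) / n%:R in
  let rho := fun w : Omega =>
    gibbs_posterior tau lambda (prior C1 vsig) (fun i => Z i w) in
  (1 <= s)%N -> (s < n)%N -> (n < d)%N ->
  l1norm thetas <= C1 - 2 * d%:R * vsig ->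
  (\int[Pr]_w (\int[rho w]_theta risk tau P theta) - risk tau P thetas <=
   (C2 * delta)%:E)%E /\
  (forall eps : R, 0 < eps < 1 ->
    ((1 - eps)%:E <=
     Pr [set w | (\int[rho w]_theta risk tau P theta - risk tau P thetas <=
                  (C2' * (delta + ln (2 / eps) / n%:R))%:E)%E])%E)].
Proof.
have lc0 : 0 <= ln (1 + C1 * Cx) by rewrite ln_ge0// lerDl mulr_ge0 ?ltW.
pose M := Num.max (2 * K) C.
have M0 : 0 < M by rewrite lt_max hC orbT.
pose C2 := 42 + M * (20 + 48 * ln (1 + C1 * Cx)).
have C20 : 0 < C2 by rewrite ltr_pwDl// mulr_ge0 ?(ltW M0)// addr_ge0// mulr_ge0.
(* The extra [8 * M] pays for the deviation term, as [8 / lambda = 8 * M / n]. *)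
exists C2, (C2 + 8 * M); split => //; first by rewrite addr_gt0// mulr_gt0.
move=> tau n d P disp Omega Pr Z thetas tau01 n0 d0 iid argmin EX bern bound.
move=> lambda vsig s delta rho s1 sn nd l1s.
have nR : 0 < n%:R :> R by rewrite ltr0n.
have sqd0 : 0 < Num.sqrt d%:R :> R by rewrite sqrtr_gt0 ltr0n.
pose g := gibbs_excess K C C1 Cx tau P Z thetas.
pose k := gibbs_rate K C C1 Cx n thetas.
(* The exponential moment concerns [lambda / 8 * g], so both the mean and the tail bound for [g]
   carry the factor [8 / lambda]. *)
have k_le : 8 / lambda * k <= C2 * delta.
  have -> : 8 / lambda = 8 * M / n%:R by rewrite /lambda -/M; field; rewrite !gt_eqF.
  exact: (rate_le hC1 hCx M0 s1 sn nd).
have lambda0 : 0 < lambda by rewrite divr_gt0.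
have k0 : 0 <= k.
  rewrite /k /gibbs_rate -/M addr_ge0 ?addr_ge0 ?mulr_ge0 ?invr_ge0 ?(ltW M0)//.
  rewrite ln_ge0// lerDl; apply: mulr_ge0; first by rewrite mulr_ge0 ?ltW.
  by rewrite divr_ge0// mulr_ge0// ltW.
have mg : measurable_fun setT g by exact: measurable_gibbs_excess.
have g0 w : 0 <= g w by exact: gibbs_excess_ge0.
have mX : measurable_fun setT (fun w => lambda / 8 * g w) by exact: measurable_funM.
have X0 w : 0 <= lambda / 8 * g w by rewrite mulr_ge0// divr_ge0// ltW.
have expX := gibbs_exponential_moment hC hC1 hCx tau01 n0 d0 iid argmin EX bern
  bound s1 l1s.
have rE := risk_argminE hC hCx tau01 n0 d0 bound l1s.
set r := fine (risk tau P thetas) in rE.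
have rhoE w : (\int[rho w]_theta risk tau P theta = (r + g w)%:E)%E.
  exact: (integral_gibbs_posterior K Z hC hCx tau01 n0 d0 argmin bound l1s).
have gE w c : (lambda / 8 * g w <= c) = (g w <= 8 / lambda * c).
  rewrite -[in RHS]ler_pdivrMl ?divr_gt0//; congr (_ <= _).
  by rewrite invf_div.
split.
  have r0 : 0 <= r.
    rewrite fine_ge0// integral_ge0// => z _.
    by rewrite lee_fin quantile_loss_ge0.
  under eq_integral do rewrite rhoE EFinD.
  rewrite ge0_integralD//; last 2 first.
  - by move=> w _; rewrite lee_fin.
  - exact/measurable_EFinP.
  rewrite integral_cst//= probability_setT mule1 rE [X in (X - _)%E]addeC addeK//.
  have := expectation_le_exponential_moment mX X0 k0 expX.
  under eq_integral do rewrite EFinM.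
  rewrite ge0_integralZl_EFin//; last 3 first.
  - by move=> w _; rewrite lee_fin.
  - exact/measurable_EFinP.
  - by rewrite divr_ge0// ltW.
  move=> Xk; apply: (@le_trans _ _ (8 / lambda * k)%:E); last by rewrite lee_fin.
  have l8 : (0%R <= (8 / lambda)%:E)%E by rewrite lee_fin divr_ge0// ltW.
  have := lee_wpmul2l l8 Xk; rewrite muleA -!EFinM.
  have -> : 8 / lambda * (lambda / 8) = 1 by field; rewrite gt_eqF.
  by rewrite mul1e.
move=> eps /andP[e0 e1].
apply: (le_trans (exponential_moment_tail mX expX e0)).
have -> : [set w | (\int[rho w]_theta risk tau P theta - risk tau P thetas <=
    ((C2 + 8 * M) * (delta + ln (2 / eps) / n%:R))%:E)%E] =
    [set w | g w <= (C2 + 8 * M) * (delta + ln (2 / eps) / n%:R)].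
  apply/funext => w; rewrite /mkset rhoE rE -EFinB lee_fin.
  by rewrite [r + _]addrC addrK.
apply: le_measure; rewrite ?inE.
- by rewrite -[X in measurable X]setTI; exact: measurable_fun_le.
- by rewrite -[X in measurable X]setTI; exact: measurable_fun_le.
move=> w /=; rewrite gE => /le_trans; apply; rewrite mulrDr.
have d0' : 0 <= C2 * delta by apply: le_trans k_le; rewrite mulr_ge0// divr_ge0// ltW.
have delta0 : 0 <= delta by move: d0'; rewrite pmulr_rge0.
have le2 : ln eps^-1 <= ln (2 / eps).
  rewrite ler_ln ?posrE ?invr_gt0// ?divr_gt0// -[leLHS]mul1r ler_pM2r ?invr_gt0//.
  lra.
have l0 : 0 <= ln (2 / eps) / n%:R.
  by rewrite divr_ge0// (le_trans _ le2)// ln_ge0// invf_ge1// ltW.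
have -> : 8 / lambda * ln eps^-1 = 8 * M * (ln eps^-1 / n%:R).
  by rewrite /lambda -/M; field; rewrite !gt_eqF.
have tail_le : 8 * M * (ln eps^-1 / n%:R) <= 8 * M * (ln (2 / eps) / n%:R).
  by rewrite ler_pM2l ?mulr_gt0// ler_pM2r ?invr_gt0.
apply: (le_trans (lerD k_le tail_le)).
(* Expanding the product gives the two needed terms and two non-negative cross terms, which are
   dropped. *)
rewrite [leRHS](_ : _ = (C2 * delta + C2 * (ln (2 / eps) / n%:R)) +
  (8 * M * delta + 8 * M * (ln (2 / eps) / n%:R))); last by ring.
apply: lerD; first by rewrite lerDl mulr_ge0// ltW.
by rewrite lerDr mulr_ge0// mulr_ge0// ltW.
Qed.
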